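(* Let $M\subset\mathbb{R}^n$ be a real analytic submanifold of dimension at least $2$ which is not contained in any proper rational affine hyperplane of $\mathbb{R}^n$, and let $\mathbf{r}=(r_1,\dots,r_n)$ satisfy $r_i>0$ for all $i$ and $\sum_{i=1}^n r_i=1$. Then there exists a totally irrational $\mathbf{x}\in M\cap\mathrm{Sing}(\mathbf{r})$.
   Context: A rational affine hyperplane is a set $\{\mathbf{x}\in\mathbb{R}^n:\langle\mathbf{x},\mathbf{v}\rangle=s\}$ with $\mathbf{v}\in\mathbb{Z}^n\setminus\{0\}$, $s\in\mathbb{Q}$. A vector $\mathbf{x}=(x_1,\dots,x_n)$ is totally irrational if $1,x_1,\dots,x_n$ are linearly independent over $\mathbb{Q}$. Put $\|\mathbf{x}\|_{\mathbf{r}}=\max_{1\le i\le n}|x_i|^{1/r_i}$ and $\mathbb{N}=\{1,2,\dots\}$. A vector $\mathbf{x}\in\mathbb{R}^n$ is $\mathbf{r}$-singular if for every $\delta>0$ there is $T_0$ such that for all $T\ge T_0$ there exist $\mathbf{p}\in\mathbb{Z}^n$ and $q\in\mathbb{N}$ with $\|q\mathbf{x}-\mathbf{p}\|_{\mathbf{r}}<\delta/T$ and $q<\delta T$. $\mathrm{Sing}(\mathbf{r})$ is the set of $\mathbf{r}$-singular vectors in $\mathbb{R}^n$.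
   Formalization: The submanifold M is additionally assumed connected; otherwise the claim fails, e.g. for the union of the planes x_1=0 and x_1=1 in R^3. For disconnected M the claim holds exactly when some component lies in no proper rational affine hyperplane; apply the theorem to that component. *)

(* Defs.v *)
From HB Require Import structures.
From mathcomp Require Import all_boot all_order all_algebra.
From mathcomp Require Import all_classical all_reals all_analysis.
From mathcomp.analysis.showcase Require Import summability.

Set Implicit Arguments.
Unset Strict Implicit.
Unset Printing Implicit Defensive.

Import Order.TTheory GRing.Theory Num.Theory.
Import numFieldNormedType.Exports.

Local Open Scope classical_set_scope.
Local Open Scope ring_scope.

Definition monomial (R : realType) (d : nat) (al : {ffun 'I_d -> nat})
    (y : 'rV[R]_d) : R :=
  \prod_(i < d) y 0 i ^+ al i.

(* The convergence along [totally] is that of the net of all finite partial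
   sums; in R^n this is absolute convergence of the multi-indexed series. *)
Definition analytic_at (R : realType) (d n : nat) (f : 'rV[R]_d -> 'rV[R]_n)
    (a : 'rV[R]_d) : Prop :=
  exists c : {ffun 'I_d -> nat} -> 'rV[R]_n,
    \forall y \near a,
      partial_sum (fun al => monomial al (y - a) *: c al) @ totally --> f y.

(* [f], restricted to the open set [W], is an analytic immersion which is a
   homeomorphism, with inverse [g], onto the open subset [M `&` U] of [M]. *)
Definition analytic_parametrization (R : realType) (d n : nat)
    (M U : set 'rV[R]_n) (W : set 'rV[R]_d)
    (f : 'rV[R]_d -> 'rV[R]_n) (g : 'rV[R]_n -> 'rV[R]_d) : Prop :=
  [/\ open U /\ open W,
      forall y, W y -> analytic_at f y,
      forall y, W y -> \rank ('J f y) = d,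
      f @` W = M `&` U /\ (forall y, W y -> g (f y) = y)
    & {within M `&` U, continuous g}].

(* Embedded submanifolds of R^n without boundary; connectedness is not part of
   this definition. *)
Definition analytic_submanifold (R : realType) (d n : nat)
    (M : set 'rV[R]_n) : Prop :=
  forall p, M p -> exists U (W : set 'rV[R]_d) f g,
    U p /\ analytic_parametrization M U W f g.

Definition rational_affine_hyperplane (R : realType) (n : nat)
    (H : set 'rV[R]_n) : Prop :=
  exists (v : 'rV[int]_n) (s : rat),
    v != 0 /\ H = [set x | \sum_(i < n) x 0 i * (v 0 i)%:~R = ratr s].

Definition totally_irrational (R : realType) (n : nat) (x : 'rV[R]_n) : Prop :=
  forall (a0 : rat) (a : 'I_n -> rat),
    ratr a0 * 1 + \sum_(i < n) ratr (a i) * x 0 i = 0 ->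
    a0 = 0 /\ forall i, a i = 0.

Definition wnorm (R : realType) (n : nat) (r : 'I_n -> R) (x : 'rV[R]_n) : R :=
  \big[Num.max/0]_(i < n) `|x 0 i| `^ (r i)^-1.

Definition Sing (R : realType) (n : nat) (r : 'I_n -> R) : set 'rV[R]_n :=
  [set x | forall delta : R, 0 < delta ->
    exists T0 : R, forall T : R, T0 <= T ->
    exists (p : 'rV[int]_n) (q : nat),
      [/\ (0 < q)%N,
          wnorm r (q%:R *: x - map_mx intr p) < delta / T
        & q%:R < delta * T]].

(* Main.v *)
(* Every point of a rational hyperplane is r-singular, uniformly on the
   hyperplane: for each delta one T0 serves all its points, by pigeonhole in the
   lattice of integer points over the hyperplane. Following Khintchine, one
   builds nested balls in a chart of M, the k-th one centred at a point of a
   rational hyperplane A_k; before leaving A_k for A_(k+1), the ball is kept so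
   close to A_k that the approximations provided by A_k last until those of
   A_(k+1) take over.

   For the transition one needs points of A_k, A_(k+1) and M in common, and near
   them points of A_(k+1) and M off the k-th rational hyperplane L. Choose d
   coordinates in which M is locally a graph. Through a point z of M where these
   coordinates are rational pass many rational lines of the coordinate space,
   and, as d >= 2, each of them lies in some rational A_(k+1). If F is the
   restriction of the equation of L to M, the lowest nonzero homogeneous part of
   the power series of F at z does not vanish on a cone; a rational line in that
   cone contains rational points arbitrarily close to z and off L. Analyticity
   and connectedness are used to exclude that F vanishes near z. *)

Require Import Defs.
From HB Require Import structures.
From mathcomp Require Import all_boot all_order all_algebra.
From mathcomp Require Import finmap.
From mathcomp Require Import all_classical all_reals all_analysis.
From mathcomp.analysis.showcase Require Import summability.
From mathcomp Require Import lra ring.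

Set Implicit Arguments.
Unset Strict Implicit.
Unset Printing Implicit Defensive.

Import Order.TTheory GRing.Theory Num.Theory.
Import numFieldNormedType.Exports.

Local Open Scope classical_set_scope.
Local Open Scope ring_scope.

(** * Rational hyperplanes are uniformly singular *)

(** Pigeonhole: the multiples [q * x] modulo 1, for [q] from 0 to [\prod_i N i], are one more than
    the boxes of sides [1 / N i], so two of them share a box. Sides of different lengths accommodate
    the weights. *)
Lemma dirichlet_simultaneous (R : realType) (n : nat) (x : 'I_n -> R)
    (N : 'I_n -> nat) (N_gt0 : forall i, (0 < N i)%N) :
  exists (q : nat) (p : 'I_n -> int),
    [/\ (0 < q)%N, (q <= \prod_i N i)%N
      & forall i, `|q%:R * x i - (p i)%:~R| < (N i)%:R^-1].
Proof.
pose fr (y : R) : R := y - (Num.floor y)%:~R.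
have fr_ge0 y : 0 <= fr y by rewrite subr_ge0 floor_le.
have fr_lt1 y : fr y < 1.
  by rewrite ltrBlDl; have := floorD1_gt y; rewrite intrD.
have cellP (q : nat) i : (Num.trunc ((N i)%:R * fr (q%:R * x i) : R)%R < N i)%N.
  rewrite truncn_lt_nat ?mulr_ge0//.
  by rewrite -[X in _ < X]mulr1 ltr_pM2l ?ltr0n.
pose cell (q : 'I_(\prod_i N i).+1) : {dffun forall i, 'I_(N i)} :=
  [ffun i => Ordinal (cellP q i)].
have /injectivePn[q1 [q2 q12 eqc]] : ~~ injectiveb cell.
  apply/injectiveP => /leq_card; rewrite card_dep_ffun foldrE big_map big_enum.
  rewrite [X in (_ <= X)%N](eq_bigr N) => [|i _]; last by rewrite card_ord.
  move=> le; have := leq_trans (eq_leq (esym (card_ord _))) le.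
  by rewrite ltnn.
wlog lt12 : q1 q2 q12 eqc / (q1 < q2)%N.
  move=> H; have := q12; rewrite -val_eqE/= neq_ltn => /orP[|]; first exact: H.
  by apply: H => //; rewrite eq_sym.
exists (q2 - q1)%N, (fun i => Num.floor (q2%:R * x i) - Num.floor (q1%:R * x i)).
split; first by rewrite subn_gt0.
  by rewrite (leq_trans (leq_subr _ _))// -ltnS.
move=> i; have := congr1 (fun g : {dffun forall i, 'I_(N i)} => val (g i)) eqc.
rewrite !ffunE/= => eqci.
have -> : (q2 - q1)%:R * x i -
    (Num.floor (q2%:R * x i) - Num.floor (q1%:R * x i))%:~R =
    fr (q2%:R * x i) - fr (q1%:R * x i).
  by rewrite natrB ?(ltnW lt12)// /fr intrB; ring.
have N0 : 0 < (N i)%:R :> R by rewrite ltr0n.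
rewrite -(ltr_pM2l N0) mulfV ?gt_eqF// -{1}(gtr0_norm N0) -normrM mulrBr.
have trP (y : R) : 0 <= y -> (Num.trunc y)%:R <= y < (Num.trunc y)%:R + 1.
  by move=> y0; rewrite natr1 truncn_itv.
have /andP[a1 b1] := trP _ (mulr_ge0 (ltW N0) (fr_ge0 (q1%:R * x i))).
have /andP[a2 b2] := trP _ (mulr_ge0 (ltW N0) (fr_ge0 (q2%:R * x i))).
rewrite eqci in a1 b1.
by rewrite ltr_norml; apply/andP; split; lra.
Qed.

(** The condition of [Sing] at a single time [T], isolated so that its uniformity in [x] and its
    stability under perturbation can be stated. *)
Definition approximable (R : realType) (n : nat) (r : 'I_n -> R)
    (delta T : R) (x : 'rV[R]_n) : Prop :=
  exists (p : 'rV[int]_n) (q : nat),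
    [/\ (0 < q)%N, wnorm r (q%:R *: x - map_mx intr p) < delta / T
      & q%:R < delta * T].

Lemma wnorm_ltP (R : realType) (n : nat) (r : 'I_n -> R) (x : 'rV[R]_n)
    (e : R) : (forall i, 0 < r i) -> 0 < e ->
  wnorm r x < e <-> forall i, `|x 0 i| < e `^ r i.
Proof.
move=> r0 e0; have powK (y : R) i : 0 <= y -> (y `^ r i) `^ (r i)^-1 = y.
  by move=> y0; rewrite -powRrM mulfV ?powRr1 ?gt_eqF.
have powVK (y : R) i : 0 <= y -> (y `^ (r i)^-1) `^ r i = y.
  by move=> y0; rewrite -powRrM mulVf ?powRr1 ?gt_eqF.
split=> [/bigmax_ltP[_ H] i|H].
  rewrite -(powVK `|x 0 i| i)//; apply: gt0_ltr_powR => //.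
  - by rewrite nnegrE powR_ge0.
  - by rewrite nnegrE ltW.
  - exact: H.
apply/bigmax_ltP; split=> // i _; rewrite -[ltRHS](powK e i) ?ltW//.
by apply: gt0_ltr_powR => //; rewrite ?invr_gt0// nnegrE ?powR_ge0.
Qed.

Lemma approximable_le (R : realType) (n : nat) (r : 'I_n -> R)
    (d1 d2 T : R) (x : 'rV[R]_n) : 0 < T -> d1 <= d2 ->
  approximable r d1 T x -> approximable r d2 T x.
Proof.
move=> T0 d12 [p [q [q0 w lq]]]; exists p, q; split=> //.
  by rewrite (lt_le_trans w)// ler_pM2r ?invr_gt0.
by rewrite (lt_le_trans lq)// ler_pM2r.
Qed.

(** The same [p] and [q] serve the whole window: halving [delta] pays for doubling the time, since
    [delta / 2 / T <= delta / t], and the strict inequalities are open in [x]. *)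
Lemma near_approximable (R : realType) (n : nat) (r : 'I_n -> R)
    (delta T : R) (x : 'rV[R]_n) :
  (forall i, 0 < r i) -> 0 < delta -> 0 < T -> approximable r (delta / 2) T x ->
  \forall y \near x, forall t, T <= t <= 2 * T -> approximable r delta t y.
Proof.
move=> r0 d0 T0 [p [q [q0 w lq]]].
have e0 : 0 < delta / 2 / T by rewrite !divr_gt0.
have /filter_forall H i : \forall y \near x,
    `|(q%:R *: y - map_mx intr p) 0 i| < (delta / 2 / T) `^ r i.
  have qR0 : 0 < q%:R :> R by rewrite ltr0n.
  move/wnorm_ltP: w => /(_ r0 e0 i); rewrite !mxE -subr_gt0 => m0.
  have /cvgrPdist_lt/(_ _ (divr_gt0 m0 qR0)) := @coord_continuous R 1 n 0 i x.
  apply: filterS => y; rewrite ltr_pdivlMr// mulrC -{1}(gtr0_norm qR0) -normrM.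
  rewrite distrC mulrBr !mxE ltrBrDl; apply: le_lt_trans.
  by apply: le_trans (ler_normD _ _); rewrite subrKA distrC.
near=> y => t /andP[Tt t2]; have t0 := lt_le_trans T0 Tt.
exists p, q; split=> //.
  have le1 : delta / 2 / T <= delta / t.
    rewrite ler_pdivlMr// mulrAC ler_pdivrMr//.
    by have := ler_wpM2l (ltW d0) t2; lra.
  apply: lt_le_trans le1; apply/wnorm_ltP => //; near: y; exact: H.
by rewrite (lt_le_trans lq)//; have := ler_wpM2l (ltW d0) Tt; nra.
Unshelve. all: by end_near. Qed.

(** Finitely many dyadic windows cover the interval, and the corresponding neighbourhoods are
    intersected. *)
Lemma near_approximable_itv (R : realType) (n : nat) (r : 'I_n -> R)
    (delta T1 T2 : R) (x : 'rV[R]_n) :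
  (forall i, 0 < r i) -> 0 < delta -> 0 < T1 ->
  (forall t, T1 <= t -> approximable r (delta / 2) t x) ->
  \forall y \near x, forall t, T1 <= t <= T2 -> approximable r delta t y.
Proof.
move=> r0 d0 T10 H.
have {H}HN (N : nat) : \forall y \near x,
    forall t, T1 <= t <= T1 * 2 ^+ N -> approximable r delta t y.
  elim: N => [|N IH].
    have H0 := near_approximable r0 d0 T10 (H _ (lexx _)).
    near=> y => t; rewrite mulr1 => /andP[a b].
    have /(_ t) : forall t, T1 <= t <= 2 * T1 -> approximable r delta t y.
      by near: y; exact: H0.
    by apply; lra.
  have T1N : T1 <= T1 * 2 ^+ N by rewrite ler_peMr ?exprn_ege1 ?ler1n ?(ltW T10).
  have H1 := near_approximable r0 d0 (lt_le_trans T10 T1N) (H _ T1N).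
  near=> y => t /andP[a b].
  have [tN|tN] := leP t (T1 * 2 ^+ N).
    have /(_ t) : forall t, T1 <= t <= T1 * 2 ^+ N -> approximable r delta t y.
      by near: y; exact: IH.
    by apply; rewrite a.
  have /(_ t) : forall t, T1 * 2 ^+ N <= t <= 2 * (T1 * 2 ^+ N) ->
      approximable r delta t y by near: y; exact: H1.
  by apply; rewrite ltW//= (le_trans b)// exprS; lra.
have [N HT] : exists N : nat, T2 <= T1 * 2 ^+ N.
  exists (Num.trunc (T2 / T1)).+1; rewrite mulrC -ler_pdivrMr//.
  apply: ltW; apply: (lt_trans (truncnS_gt _)).
  by rewrite -natrX ltr_nat ltn_expl.
near=> y => t /andP[a b].
have /(_ t) : forall t, T1 <= t <= T1 * 2 ^+ N -> approximable r delta t y.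
  by near: y; exact: HN.
by apply; rewrite a (le_trans b).
Unshelve. all: by end_near. Qed.

(** On the hyperplane one coordinate [i0] is determined by the others, so Dirichlet need only handle
    the latter. This costs [q] of order [T] to the power [1 - r i0], eventually below [delta * T],
    with constants independent of [x]. *)
Lemma hyperplane_approximable (R : realType) (n : nat) (r : 'I_n -> R)
    (v : 'rV[int]_n) (s : int) (delta : R) :
  (forall i, 0 < r i) -> \sum_i r i = 1 -> v != 0 -> 0 < delta ->
  exists T0 : R, forall (T : R) (x : 'rV[R]_n), T0 <= T ->
    \sum_i x 0 i * (v 0 i)%:~R = s%:~R -> approximable r delta T x.
Proof.
move=> r0 r1 /rV0Pn[j0 vj0] d0.
have [i0 vi0 rmin] := @arg_minP _ _ _ j0 (fun i => v 0 i != 0) r vj0.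
(* [C] pays for solving the equation for coordinate [i0], [D] for multiplying the denominator by
   [v 0 i0], [E] for the factors [delta]^ r j[;]B[is the value that]T [^ r i0] must exceed to give
   [q < delta * T]. *)
pose C : R := 1 + \sum_(j | j != i0) `|(v 0 j)%:~R|.
have C1 : 1 <= C by rewrite lerDl sumr_ge0.
pose D : R := `|(v 0 i0)%:~R|.
have D1 : 1 <= D.
  by rewrite /D -intr_norm ler1z -gtz0_ge1 normr_gt0.
pose E : R := 1 + \sum_j (delta `^ r j)^-1.
have E1 : 1 <= E by rewrite lerDl sumr_ge0// => j _; rewrite invr_ge0 powR_ge0.
pose K := C * D * E.
have K1 : 1 <= K by rewrite !mulr_ege1.
pose B := D * (2 * K) ^+ n / delta.
have B0 : 0 <= B by rewrite divr_ge0 ?mulr_ge0 ?exprn_ge0 ?mulr_ge0//; lra.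
exists (1 + delta + (B + 1) `^ (r i0)^-1) => T x T0 xA.
have pw0 := powR_ge0 (B + 1) (r i0)^-1.
have T1 : 1 <= T by lra.
have Tgt0 : 0 < T by lra.
have TrB : B < T `^ r i0.
  have : (B + 1) `^ (r i0)^-1 <= T by lra.
  move=> /(ge0_ler_powR (ltW (r0 i0))); rewrite -powRrM mulVf ?gt_eqF//.
  by rewrite powRr1 ?nnegrE; [move=> /(_ pw0 (ltW Tgt0)); lra|lra].
have Tr1 j : 1 <= T `^ r j.
  have /(ge0_ler_powR (ltW (r0 j))) := T1.
  by rewrite powR1; apply; rewrite nnegrE ?ltW.
(* With a single box, coordinate [i0] adds nothing to the bound on [q']. *)
pose N j := if j == i0 then 1%N else (Num.trunc (K * T `^ r j)).+1.
have N_gt0 j : (0 < N j)%N by rewrite /N; case: ifP.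
have [q' [p' [q'0 q'N appr]]] := dirichlet_simultaneous (x 0) N_gt0.
pose e j := (delta / T) `^ r j.
have dT0 : 0 < delta / T by rewrite divr_gt0.
have e0 j : 0 < e j by rewrite powR_gt0.
pose q := (absz (v 0%R i0) * q')%N.
have qE : q%:R = D * q'%:R :> R by rewrite natrM natr_absz intr_norm.
(* The numerators satisfy the equation of the hyperplane with right-hand side [s * q]: the
   approximating rational point lies on the hyperplane itself. *)
pose pj j : int := if j == i0 then
  sgz (v 0 i0) * (s * q'%:Z - \sum_(k | k != i0) v 0 k * p' k)
  else `|v 0 i0| * p' j.
have eT j : e j * T `^ r j = delta `^ r j.
  by rewrite /e -powRM ?ltW// divfK ?gt_eqF.
have NK j : j != i0 -> K * T `^ r j < (N j)%:R <= 2 * K * T `^ r j.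
  move=> ji; rewrite /N (negbTE ji) truncnS_gt/= -natr1.
  have KT1 : 1 <= K * T `^ r j by rewrite mulr_ege1.
  have : (Num.trunc (K * T `^ r j))%:R <= K * T `^ r j :> R.
    by rewrite truncn_le; lra.
  by rewrite -mulrA; lra.
have small j : j != i0 -> `|q%:R * x 0 j - (pj j)%:~R| < e j / C.
  move=> ji; rewrite /pj (negbTE ji) qE intrM intr_norm -/D -mulrA -mulrBr.
  rewrite normrM ger0_norm; last lra.
  have D0 : 0 < D by lra.
  have N0 : 0 < (N j)%:R :> R by rewrite ltr0n.
  have := appr j; rewrite -(ltr_pM2l D0) => /lt_le_trans; apply.
  rewrite ler_pdivrMr// mulrAC ler_pdivlMr; last lra.
  have /andP[/ltW + _] := NK _ ji; rewrite -(ler_pM2l (e0 j)); apply: le_trans.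
  rewrite mulrCA eT /K -!mulrA (mulrC D) ler_pM2l; last lra.
  rewrite ler_peMr//; first lra.
  have dr0 : 0 < delta `^ r j by rewrite powR_gt0.
  rewrite -ler_pdivrMr// div1r /E (bigD1 j)//=.
  have : 0 <= \sum_(i | i != j) (delta `^ r i)^-1.
    by rewrite sumr_ge0// => k _; rewrite invr_ge0 powR_ge0.
  lra.
have small0 : `|q%:R * x 0 i0 - (pj i0)%:~R| < e i0.
  have eqi0 : (v 0 i0)%:~R * (q%:R * x 0 i0 - (pj i0)%:~R) =
      - \sum_(j | j != i0) (v 0 j)%:~R * (q%:R * x 0 j - (pj j)%:~R) :> R.
    have -> : \sum_(j | j != i0) (v 0 j)%:~R * (q%:R * x 0 j - (pj j)%:~R) =
        q%:R * (\sum_(j | j != i0) x 0 j * (v 0 j)%:~R) -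
        D * (\sum_(j | j != i0) (v 0 j)%:~R * (p' j)%:~R) :> R.
      rewrite !mulr_sumr -sumrB; apply: eq_bigr => j ji.
      by rewrite /pj (negbTE ji) intrM intr_norm -/D; ring.
    have -> : \sum_(j | j != i0) x 0 j * (v 0 j)%:~R =
        s%:~R - x 0 i0 * (v 0 i0)%:~R.
      by rewrite -xA [in RHS](bigD1 i0)//=; ring.
    have vsg : (v 0 i0)%:~R * (sgz (v 0 i0))%:~R = D.
      by rewrite mulrC -intrM -abszEsg abszE intr_norm.
    rewrite /pj eqxx mulrBr intrM mulrA vsg intrB intrM rmorph_sum/= qE.
    by under [in LHS]eq_bigr do rewrite intrM; ring.
  have le1 : `|q%:R * x 0 i0 - (pj i0)%:~R| <= D * `|q%:R * x 0 i0 - (pj i0)%:~R|.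
    by rewrite ler_peMl.
  apply: le_lt_trans le1 _; rewrite /D -normrM eqi0 normrN.
  apply: le_lt_trans (ler_norm_sum _ _ _) _.
  apply: (@le_lt_trans _ _ (\sum_(j | j != i0) `|(v 0 j)%:~R| * (e i0 / C))).
    apply: ler_sum => j ji; rewrite normrM.
    have [->|vj] := eqVneq (v 0 j) 0; first by rewrite normr0 !mul0r.
    rewrite ler_wpM2l// (le_trans (ltW (small _ ji)))// ler_pM2r ?invr_gt0; last lra.
    apply: ger_powR; last exact: rmin.
    by rewrite dT0 ler_pdivrMr// mul1r; lra.
  rewrite -mulr_suml mulrCA -ltr_pdivlMl// mulVf ?gt_eqF//.
  by rewrite ltr_pdivrMr ?mul1r ?ltrDr // (lt_le_trans ltr01 C1).
exists (\row_j pj j), q; split.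
- by rewrite muln_gt0 q'0 andbT absz_gt0.
- apply/wnorm_ltP => // j; rewrite !mxE; have [->//|ji] := eqVneq j i0.
  by rewrite (lt_le_trans (small _ ji))// ler_pdivrMr ?ler_peMr// 1?ltW//; lra.
- have prodN : (\prod_i N i)%:R * T `^ r i0 <= (2 * K) ^+ n * T :> R.
    have -> : (2 * K) ^+ n * T = \prod_i (2 * K * T `^ r i).
      rewrite big_split/= prodr_const card_ord; congr (_ * _).
      rewrite -[LHS]powRr1 ?(ltW Tgt0)// -r1.
      elim/big_rec2: _ => [|i y z _ <-]; first by rewrite powRr0.
      by rewrite powRD// (gt_eqF Tgt0) implybT.
    rewrite (bigD1 i0)//= {1}/N eqxx mul1n [leRHS](bigD1 i0)//= mulrC.
    apply: ler_pM; rewrite ?powR_ge0//.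
      by rewrite ler_peMl ?powR_ge0//; lra.
    rewrite natr_prod; apply: ler_prod => j ji.
    by rewrite ler0n; have /andP[] := NK _ ji.
  rewrite qE -(ltr_pM2r (lt_le_trans ltr01 (Tr1 i0))).
  have : D * (q'%:R * T `^ r i0) <= D * ((2 * K) ^+ n * T).
    apply: ler_wpM2l; first lra.
    apply: le_trans prodN.
    by rewrite ler_wpM2r ?powR_ge0// ler_nat.
  have : B * (delta * T) < T `^ r i0 * (delta * T) by rewrite ltr_pM2r ?mulr_gt0.
  have -> : B * (delta * T) = D * ((2 * K) ^+ n * T).
    by rewrite /B; field; rewrite gt_eqF.
  by move=> /le_lt_trans H /H; rewrite mulrA [X in _ < X]mulrC.
Qed.

(** * Power series in several variables *)

#[local] Existing Instance totally_filter.

Section FiniteSums.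
Variables (R : realType) (I : choiceType).
Implicit Types (a : I -> R) (A B S : {fset I}).

Lemma partial_sumE a S : partial_sum a S = \sum_(i <- S) a i.
Proof. by rewrite /partial_sum big_seq_fsetE. Qed.

Lemma sum_fsubset a A B : (A `<=` B)%fset ->
  \sum_(i <- B) a i = \sum_(i <- A) a i + \sum_(i <- B | i \notin A) a i.
Proof.
move=> /fsubsetP AB; rewrite (bigID (mem A))/=; congr (_ + _).
rewrite big_fset_condE; apply: eq_fbigl => i.
by rewrite !inE/=; apply/andP/idP => [[]//|iA]; rewrite AB.
Qed.

Lemma ler_sum_cond (P : pred I) a S : (forall i, 0 <= a i) ->
  \sum_(i <- S | P i) a i <= \sum_(i <- S) a i.
Proof.
by move=> a0; rewrite [leRHS](bigID P)/= lerDl sumr_ge0.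
Qed.

(** A finite sum off a suitable finite set [A] is a difference of two partial sums close to [l], so
    all finite sums are bounded. Summing the nonnegative and the negative terms separately gives the
    factor 2. *)
Lemma totally_abs_bounded a (l : R) : partial_sum a @ totally --> l ->
  exists C : R, forall S, \sum_(i <- S) `|a i| <= C.
Proof.
move=> /cvgrPdist_lt cvg_l; have [A _ HA] := cvg_l _ ltr01.
have Hs S : `|\sum_(i <- S) a i| <= 2 + \sum_(i <- A) `|a i|.
  rewrite (bigID (mem A))/= addrC; apply: le_trans (ler_normD _ _) _.
  apply: lerD; last first.
    rewrite big_fset_condE; apply: le_trans (ler_norm_sum _ _ _) _.
    rewrite (@sum_fsubset _ [fset x in S | x \in A]%fset A).
      by rewrite lerDl sumr_ge0.
    by apply/fsubsetP => i; rewrite !inE/= => /andP[].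
  have -> : \sum_(i <- S | i \notin A) a i =
      (l - \sum_(i <- A) a i) - (l - \sum_(i <- (A `|` S)%fset) a i).
    rewrite (@sum_fsubset _ A (A `|` S)%fset) ?fsubsetUl//.
    rewrite opprB addrC subrKA [in RHS]addrC addKr.
    apply: eq_fbig_cond => // i; rewrite !inE/=.
    by case: (i \in A); rewrite ?andbF.
  have h1 := HA A (fsubset_refl _); have h2 := HA _ (fsubsetUl A S).
  rewrite /= !partial_sumE in h1 h2.
  by apply: le_trans (ler_normB _ _) _; rewrite ltW// -natr1 ltrD// mulr1n.
exists (2 * (2 + \sum_(i <- A) `|a i|)) => S.
rewrite (bigID (fun i => 0 <= a i))/= mulrDl mul1r.
apply: lerD.
  rewrite (eq_bigr a) => [|i /ger0_norm//].
  by rewrite big_fset_condE; exact: le_trans (ler_norm _) (Hs _).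
rewrite (eq_bigr (fun i => - a i)) => [|i].
  rewrite sumrN big_fset_condE; apply: le_trans (ler_norm _) _.
  by rewrite normrN.
by rewrite -ltNge => /ltr0_norm.
Qed.

Lemma totally_dist_le a (l : R) A (e : R) : partial_sum a @ totally --> l ->
  (forall S, (A `<=` S)%fset -> `|\sum_(i <- S | i \notin A) a i| <= e) ->
  `|l - \sum_(i <- A) a i| <= e.
Proof.
move=> al H; apply/ler_addgt0Pr => t t0.
move/cvgrPdist_lt: al => cvg_l; have [B _ HB] := cvg_l _ t0.
have := HB (A `|` B)%fset (fsubsetUr _ _); rewrite /= partial_sumE => Ht.
have := H (A `|` B)%fset (fsubsetUl _ _).
rewrite (@sum_fsubset _ A) ?fsubsetUl// in Ht *; move: Ht.
set x := \sum_(i <- A) _; set y := \sum_(i <- _ | _) _ => Ht Hy.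
have -> : l - x = y + (l - (x + y)) by ring.
by apply: le_trans (ler_normD _ _) _; rewrite lerD// ltW.
Qed.

End FiniteSums.

Section Monomials.
Variables (R : realType) (d : nat).
Implicit Types (h : 'rV[R]_d) (al : {ffun 'I_d -> nat}).

Lemma ler_norm_coord h i : `|h 0 i| <= `|h|.
Proof.
rewrite [leRHS]/Num.norm/= mx_normrE.
exact: (le_bigmax _ (fun ij : 'I_1 * 'I_d => `|h ij.1 ij.2|) (0, i)).
Qed.

Lemma norm_le_coord h (e : R) : 0 <= e -> (forall i, `|h 0 i| <= e) -> `|h| <= e.
Proof.
move=> e0 H; rewrite [leLHS]/Num.norm/= mx_normrE.
by apply: bigmax_le => // -[i j] _ /=; rewrite (ord1 i).
Qed.

Definition mdeg al : nat := (\sum_(i < d) al i)%N.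

Lemma monomialZ al (s : R) h : monomial al (s *: h) = s ^+ mdeg al * monomial al h.
Proof.
rewrite /monomial /mdeg expr_sum -big_split; apply: eq_bigr => i _.
by rewrite mxE exprMn.
Qed.

Lemma monomial_const al (s : R) : monomial al (const_mx s) = s ^+ mdeg al.
Proof. by rewrite /monomial /mdeg expr_sum; apply: eq_bigr => i _; rewrite mxE. Qed.

Lemma monomial_deg0 al h : mdeg al = 0%N -> monomial al h = 1.
Proof.
move=> /eqP; rewrite sum_nat_eq0 => /forallP H; apply: big1 => i _.
by move/implyP: (H i) => /(_ isT)/eqP ->.
Qed.

Lemma monomial_deg1 al h : mdeg al = 1%N ->
  monomial al h = \sum_(i < d) h 0 i * (al i)%:R.
Proof.
rewrite /mdeg => al1.
have /existsP[i ali] : [exists i, al i != 0%N].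
  apply: contra_eqT al1 => /existsPn H; rewrite big1// => i _.
  by apply/eqP; rewrite -[_ == _]negbK; exact: H.
move: al1; rewrite (bigD1 i)//= => al1.
have ali1 : al i = 1%N by move: al1 ali; case: (al i) => [|[|k]].
have alj j : j != i -> al j = 0%N.
  move: al1; rewrite ali1 add1n => -[/eqP]; rewrite sum_nat_eq0.
  by move=> /forallP/(_ j)/implyP H /H /eqP.
rewrite /monomial (bigD1 i)//= [RHS](bigD1 i)//= ali1 expr1 mulr1.
rewrite big1 => [|j ji]; last by rewrite alj.
by rewrite big1 ?mulr1 ?addr0// => j ji; rewrite alj// mulr0.
Qed.

(* [m] is the degree of a monomial taking the values [x] and [y] at two points
   of norm at most [r] and mutual distance [e]; the bound is stable under
   products, which yields the Lipschitz estimate below. *)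
Let close (r e : R) (m : nat) (x y : R) :=
  [/\ `|x| <= r ^+ m, `|y| <= r ^+ m & r * `|x - y| <= m%:R * r ^+ m * e].

Let close1 r e : close r e 0 1 1.
Proof. by split; rewrite ?normr1 ?expr0// subrr normr0 mulr0 mul0r mul0r. Qed.

Let closeM r e m1 x1 y1 m2 x2 y2 : 0 <= r -> close r e m1 x1 y1 ->
  close r e m2 x2 y2 -> close r e (m1 + m2) (x1 * x2) (y1 * y2).
Proof.
move=> r0 [xr1 yr1 xy1] [xr2 yr2 xy2].
split; first 1 [by rewrite normrM exprD ler_pM | by rewrite normrM exprD ler_pM|].
have -> : x1 * x2 - y1 * y2 = x1 * (x2 - y2) + y2 * (x1 - y1) by ring.
apply: (@le_trans _ _ (r * (`|x1| * `|x2 - y2| + `|y2| * `|x1 - y1|))).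
  by rewrite ler_wpM2l//; apply: le_trans (ler_normD _ _) _; rewrite !normrM.
have := ler_pM (normr_ge0 x1) (mulr_ge0 r0 (normr_ge0 (x2 - y2))) xr1 xy2.
have := ler_pM (normr_ge0 y2) (mulr_ge0 r0 (normr_ge0 (x1 - y1))) yr2 xy1.
rewrite natrD exprD; set a := `|x1|; set b := `|y2|; lra.
Qed.

Let close_monomial (r e : R) al h h' : 0 <= r -> `|h| <= r -> `|h'| <= r ->
  `|h - h'| <= e -> close r e (mdeg al) (monomial al h) (monomial al h').
Proof.
move=> r0 hr hr' he; rewrite /monomial /mdeg.
have : forall i : 'I_d, close r e (al i) (h 0 i ^+ al i) (h' 0 i ^+ al i).
  move=> i; elim: (al i) => [|k IH]; first exact: close1.
  rewrite !exprS -add1n; apply: closeM => //; split.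
  - by rewrite expr1 (le_trans (ler_norm_coord _ _)).
  - by rewrite expr1 (le_trans (ler_norm_coord _ _)).
  - rewrite expr1 mul1r ler_wpM2l//; apply: le_trans he.
    by have := ler_norm_coord (h - h') i; rewrite !mxE.
move=> H; elim/big_rec3: _ => [|i x y m _ IH]; first exact: close1.
exact: closeM.
Qed.

Lemma ler_norm_monomial al h (r : R) : `|h| <= r -> `|monomial al h| <= r ^+ mdeg al.
Proof.
move=> hr; have r0 := le_trans (normr_ge0 h) hr.
by have [] := @close_monomial r _ al h h r0 hr hr (lexx _).
Qed.

Lemma monomial_lipschitz al (r : R) h h' : `|h| <= r -> `|h'| <= r ->
  r * `|monomial al h - monomial al h'| <= (mdeg al)%:R * r ^+ mdeg al * `|h - h'|.
Proof.
move=> hr hr'; have r0 := le_trans (normr_ge0 h) hr.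
by have [] := @close_monomial r _ al h h' r0 hr hr' (lexx _).
Qed.

(* Locked, since [inE] would otherwise expand membership in it. *)
Definition degset k : {fset {ffun 'I_d -> nat}} :=
  locked
    [fset al in [seq [ffun i => nat_of_ord (g i)] | g : {ffun 'I_d -> 'I_k}] |
      (mdeg al < k)%N]%fset.

Lemma mem_degset k al : (al \in degset k) = (mdeg al < k)%N.
Proof.
rewrite /degset -lock !inE/= andb_idl// => alk.
have lt i : (al i < k)%N.
  by apply: leq_ltn_trans alk; rewrite /mdeg (bigD1 i)//= leq_addr.
have : al \in codom (fun g : {ffun 'I_d -> 'I_k} => [ffun i => nat_of_ord (g i)]).
  apply/codomP; exists [ffun i => Ordinal (lt i)].
  by apply/ffunP => i; rewrite !ffunE.
by [].
Qed.

Lemma degsetS k : (degset k `<=` degset k.+1)%fset.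
Proof. by apply/fsubsetP => al; rewrite !mem_degset; exact: ltnW. Qed.

End Monomials.

Section Expansion.
Variables (R : realType) (d : nat).
Implicit Types (F : 'rV[R]_d -> R) (z h u w : 'rV[R]_d)
  (c : {ffun 'I_d -> nat} -> R).

Definition expands_at F z c : Prop :=
  \forall y \near z, partial_sum (fun al => monomial al (y - z) * c al) @ totally
    --> F y.

(** Cauchy's estimate: at the point with all coordinates [rho], of sup norm [rho], each monomial is
    [rho] to its degree, and convergence there is absolute. *)
Lemma expands_at_bounded F z c : expands_at F z c -> exists C rho : R,
  [/\ 0 <= C, 0 < rho,
    forall S : {fset {ffun 'I_d -> nat}}, \sum_(al <- S) `|c al| * rho ^+ mdeg al <= C
    & forall h, `|h| <= rho ->
      partial_sum (fun al => monomial al h * c al) @ totally --> F (z + h)].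
Proof.
move=> /nbhs_normP[e /= e0 He].
have cvgF h : `|h| <= e / 2 ->
    partial_sum (fun al => monomial al h * c al) @ totally --> F (z + h).
  move=> he; have := He (z + h); rewrite /ball_/= opprD addNKr normrN.
  by rewrite [z + h - z]addrC addKr; apply; lra.
have rho0 : 0 < e / 2 by lra.
have [|C HC] := totally_abs_bounded (cvgF (const_mx (e / 2)) _).
  by apply: norm_le_coord => [|i]; rewrite ?mxE ?gtr0_norm// ltW.
have HC' (S : {fset {ffun 'I_d -> nat}}) : \sum_(al <- S) `|c al| * (e / 2) ^+ mdeg al <= C.
  apply: le_trans (HC S); apply: ler_sum => al _.
  by rewrite monomial_const normrM mulrC ger0_norm// exprn_ge0 ?ltW.
exists C, (e / 2); split => //.
by have := HC' fset0; rewrite big_seq_fset0.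
Qed.

(** The homogeneous part of degree [k]; [degset] only serves to make the index set finite. *)
Definition hpart c (k : nat) h : R :=
  \sum_(al <- degset d k.+1 | mdeg al == k) monomial al h * c al.

Lemma hpartZ c k (s : R) h : hpart c k (s *: h) = s ^+ k * hpart c k h.
Proof.
rewrite /hpart mulr_sumr; apply: eq_bigr => al /eqP alk.
by rewrite monomialZ alk mulrA.
Qed.

Lemma sum_hpart c k h :
  \sum_(al <- degset d k) monomial al h * c al = \sum_(j < k) hpart c j h.
Proof.
elim: k => [|k IH].
  by rewrite big_ord0 big1_fset// => al; rewrite mem_degset.
rewrite big_ord_recr/= -IH (sum_fsubset _ (degsetS d k)).
congr (_ + _); apply: eq_fbig_cond => // al.
by rewrite !inE/= !mem_degset ltnS -leqNgt eqn_leq; case: leqP.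
Qed.

Lemma hpart_lipschitz c k u : exists K : R, 0 <= K /\ forall w,
  `|w - u| <= 1 -> `|hpart c k w - hpart c k u| <= K * `|w - u|.
Proof.
pose r := `|u| + 1; have r0 : 0 < r by rewrite ltr_wpDl.
exists (\sum_(al <- degset d k.+1 | mdeg al == k)
  (mdeg al)%:R * r ^+ mdeg al * `|c al| / r).
split.
  by apply: sumr_ge0 => al _; rewrite !mulr_ge0 ?invr_ge0 ?exprn_ge0 ?(ltW r0).
move=> w wu; rewrite /hpart -sumrB mulr_suml.
apply: le_trans (ler_norm_sum _ _ _) _; apply: ler_sum => al _.
rewrite -mulrBl normrM -(ler_pM2l r0) mulrA.
have -> : r * ((mdeg al)%:R * r ^+ mdeg al * `|c al| / r * `|w - u|) =
    (mdeg al)%:R * r ^+ mdeg al * `|w - u| * `|c al|.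
  by field; rewrite gt_eqF.
rewrite ler_wpM2r//; apply: monomial_lipschitz; last by rewrite lerDl.
by rewrite -(subrK u w) addrC; apply: le_trans (ler_normD _ _) _; rewrite lerD2l.
Qed.

(** Absorbs the degree factor of [monomial_lipschitz] when summing over all degrees at least 2. *)
Lemma natr_exp_half (k : nat) (t : R) : 0 <= t -> t <= 2^-1 ->
  k.+2%:R * t ^+ k <= 2.
Proof.
move=> t0 t2; elim: k => [|k IH]; first by rewrite mulr1.
apply: le_trans IH; rewrite exprS mulrA ler_wpM2r ?exprn_ge0//.
apply: (@le_trans _ _ (k.+3%:R * 2^-1)); first by rewrite ler_wpM2l.
by rewrite -natr1 -[k.+2%:R]natr1 -natr1; have := ler0n R k; lra.
Qed.

Section Bounded.
Variables (F : 'rV[R]_d -> R) (z : 'rV[R]_d) (c : {ffun 'I_d -> nat} -> R).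
Variables (C rho : R).
Hypotheses (C0 : 0 <= C) (rho0 : 0 < rho)
  (HC : forall S : {fset {ffun 'I_d -> nat}}, \sum_(al <- S) `|c al| * rho ^+ mdeg al <= C)
  (HF : forall h : 'rV[R]_d, `|h| <= rho ->
      partial_sum (fun al => monomial al h * c al) @ totally --> F (z + h)).

Lemma taylor k h : `|h| <= rho ->
  `|F (z + h) - \sum_(j < k) hpart c j h| <= C * (`|h| / rho) ^+ k.
Proof.
move=> hrho; rewrite -sum_hpart; apply: (totally_dist_le (HF hrho)) => S _.
have th0 : 0 <= `|h| / rho by rewrite divr_ge0// ltW.
apply: le_trans (ler_norm_sum _ _ _) _.
apply: (@le_trans _ _ (\sum_(al <- S | al \notin degset d k)
    (`|c al| * rho ^+ mdeg al) * (`|h| / rho) ^+ k)).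
  apply: ler_sum => al; rewrite mem_degset -leqNgt => kal.
  rewrite normrM mulrC -mulrA ler_wpM2l//.
  apply: le_trans (ler_norm_monomial al (lexx _)) _.
  have -> : `|h| ^+ mdeg al = rho ^+ mdeg al * (`|h| / rho) ^+ mdeg al.
    by rewrite -exprMn mulrCA mulfV ?mulr1// gt_eqF.
  rewrite ler_wpM2l ?exprn_ge0 ?(ltW rho0)//.
  by apply: ler_wiXn2l => //; rewrite ler_pdivrMr// mul1r.
rewrite -mulr_suml ler_wpM2r ?exprn_ge0//; apply: le_trans (HC S).
by apply: ler_sum_cond => al; rewrite mulr_ge0 ?exprn_ge0 ?(ltW rho0).
Qed.

Lemma eq0_of_hpart_eq0 h : `|h| <= rho / 2 -> (forall k, hpart c k h = 0) -> F (z + h) = 0.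
Proof.
move=> hr h0; apply/eqP; rewrite -normr_le0; apply/ler_addgt0Pr => e e0.
rewrite add0r.
have hr1 : `|h| <= rho by apply: le_trans hr _; move: rho0 => rho0'; lra.
have [k Hk] : exists k : nat, C * (2^-1 : R) ^+ k <= e.
  exists (Num.trunc (C / e)).+1; rewrite exprVn ler_pdivrMr ?exprn_gt0//.
  rewrite mulrC -ler_pdivrMr//; apply: ltW; apply: lt_trans (truncnS_gt _) _.
  by rewrite -natrX ltr_nat ltn_expl.
have := taylor k hr1; rewrite big1 ?subr0 => [|j _//]; move=> /le_trans; apply.
apply: le_trans Hk; rewrite ler_wpM2l//; apply: lerXn2r.
- by rewrite nnegrE divr_ge0// ltW.
- by rewrite nnegrE invr_ge0.
- by rewrite ler_pdivrMr// mulrC.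
Qed.

(** [F (z + s *: w)] is [s ^+ k * hpart c k w] up to a remainder of order [k.+1] in [s]. The
    threshold [e] depends on [w] only through [m] and [q], so it serves a whole cone of
    directions. *)
Lemma neq0_of_hpart (k : nat) (q m : R) : 0 < q -> 0 < m ->
  exists e : R, 0 < e /\ forall s w, 0 < `|s| -> `|s| <= e -> `|w| <= m ->
    (forall j, (j < k)%N -> hpart c j w = 0) -> q <= `|hpart c k w| ->
    F (z + s *: w) != 0.
Proof.
move=> q0 m0; pose B := C * (m / rho) ^+ k.+1.
have mr0 : 0 < m / rho by rewrite divr_gt0.
have B0 : 0 <= B by rewrite mulr_ge0// exprn_ge0// ltW.
(* The first bound keeps [s *: w] in the domain of the expansion, the second makes the remainder,
   divided by [|s| ^+ k], at most [q / 2]. *)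
exists (Num.min (rho / m) (q / (B + 1) / 2)).
split; first by rewrite lt_min !divr_gt0// ltr_wpDl.
move=> s w s0; rewrite le_min => /andP[sr sq] wm hj hk.
apply/negP => /eqP F0.
have swr : `|s *: w| <= rho.
  rewrite normrZ; apply: le_trans (ler_pM _ _ sr wm) _ => //.
  by rewrite divfK ?gt_eqF.
have := taylor k.+1 swr; rewrite F0 sub0r normrN big_ord_recr/= big1; last first.
  by move=> j _; rewrite hpartZ hj ?mulr0.
have -> : C * (`|s *: w| / rho) ^+ k.+1 =
    `|s| ^+ k * (`|s| * (C * (`|w| / rho) ^+ k.+1)).
  by rewrite normrZ -mulrA exprMn exprS; ring.
rewrite add0r hpartZ normrM normrX ler_pM2l ?exprn_gt0// => H.
have : q <= `|s| * B.
  apply: le_trans hk _; apply: le_trans H _; rewrite ler_wpM2l// ler_wpM2l//.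
  rewrite lerXn2r ?nnegrE ?divr_ge0 ?(ltW rho0) ?(ltW m0)//.
  by rewrite ler_pM2r ?invr_gt0.
have : `|s| * B <= q / (B + 1) / 2 * (B + 1) by rewrite ler_pM//; lra.
have -> : q / (B + 1) / 2 * (B + 1) = q / 2 by field; rewrite gt_eqF// ltr_wpDl.
lra.
Qed.

End Bounded.

(** Isolated zeros in one variable: along the line, the values [hpart c k u] are the coefficients of
    a power series in [s]; either all vanish or the first nonzero one dominates. *)
Lemma line_dichotomy F z c u : expands_at F z c ->
  (exists2 e : R, 0 < e & forall s, `|s| < e -> F (z + s *: u) = 0) \/
  (exists2 e : R, 0 < e & forall s, 0 < `|s| -> `|s| < e -> F (z + s *: u) <> 0).
Proof.
move=> /expands_at_bounded[C [rho [C0 rho0 HC HF]]].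
have [u0|/existsNP[k0 /eqP hk0]] := pselect (forall k, hpart c k u = 0).
  left; exists (rho / 2 / (`|u| + 1)); first by rewrite !divr_gt0// ltr_wpDl.
  move=> s; rewrite ltr_pdivlMr ?ltr_wpDl// => sr; apply: (eq0_of_hpart_eq0 C0 rho0 HC HF) => [|k].
    by rewrite normrZ; apply: le_trans (ltW sr); rewrite ler_wpM2l// lerDl.
  by rewrite hpartZ u0 mulr0.
right; have exk : exists k, hpart c k u != 0 by exists k0.
case: (ex_minnP exk) => k hk kmin.
have [||e [e0 He]] := @neq0_of_hpart F z c C rho C0 rho0 HC HF k `|hpart c k u| (`|u| + 1).
- by rewrite normr_gt0.
- by rewrite ltr_wpDl.
exists e => // s s0 se; apply/eqP; apply: He => //; [exact: ltW|by rewrite lerDl|].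
move=> j jk; apply/eqP; apply: contraTT jk => /kmin; by rewrite -leqNgt.
Qed.

(** Here [k] is the lowest degree whose part is not identically zero, so lower parts vanish in every
    direction; by [hpart_lipschitz] the part of degree [k] keeps half its size near [u]. *)
Lemma nonvanishing_cone F z c : expands_at F z c ->
  ~ (\forall y \near z, F y = 0) ->
  exists (u : 'rV[R]_d) (e : R), 0 < e /\
    forall s w, 0 < s -> s <= e -> `|w - u| <= e -> F (z + s *: w) <> 0.
Proof.
move=> /expands_at_bounded[C [rho [C0 rho0 HC HF]]] nF.
have [h0|] := pselect (forall k h, hpart c k h = 0).
  case: nF; apply/nbhs_normP; exists (rho / 2) => /=; first by rewrite divr_gt0.
  move=> y; rewrite /ball_/= distrC => yz; rewrite -[y](subrK z) addrC.
  by apply: (eq0_of_hpart_eq0 C0 rho0 HC HF); [exact: ltW|].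
move=> /existsNP[k0 /existsNP[u0 hk0]].
have exk : exists k, `[< exists u, hpart c k u != 0 >].
  by exists k0; apply/asboolP; exists u0; apply/eqP.
case: (ex_minnP exk) => k /asboolP[u hku] kmin.
have [K [K0 HK]] := hpart_lipschitz c k u.
have [||e [e0 He]] := @neq0_of_hpart F z c C rho C0 rho0 HC HF k (`|hpart c k u| / 2) (`|u| + 1).
- by rewrite divr_gt0 ?normr_gt0.
- by rewrite ltr_wpDl.
have q0 : 0 < `|hpart c k u| / 2 by rewrite divr_gt0 ?normr_gt0.
pose t := Num.min 1 ((`|hpart c k u| / 2) / (K + 1)).
exists u, (Num.min e t); split.
  by rewrite lt_min e0 lt_min ltr01/= divr_gt0// ltr_wpDl.
move=> s w s0; rewrite !le_min => /andP[se _] /andP[_ /andP[w1 wK]].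
apply/eqP; apply: He.
- by rewrite gtr0_norm.
- by rewrite gtr0_norm.
- rewrite -(subrK u w) addrC; apply: le_trans (ler_normD _ _) _.
  by rewrite lerD2l.
- move=> j jk; apply/eqP; apply: contraTT jk => hj; rewrite -leqNgt; apply: kmin.
  by apply/asboolP; exists w.
- have : K * `|w - u| <= `|hpart c k u| / 2.
    move: wK; rewrite ler_pdivlMr ?ltr_wpDl// => /(le_trans _); apply.
    by rewrite mulrC ler_wpM2l// lerDl.
  move=> /(le_trans (HK _ w1)); rewrite distrC => H.
  by have := lerB_dist (hpart c k u) (hpart c k w); lra.
Qed.

(** Both points move, as local inversion requires. In the difference the constant terms cancel and
    the linear ones are subtracted; the Lipschitz constant of the rest is of order [r]. *)
Lemma strict_differentiability F z c : expands_at F z c ->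
  exists a : 'I_d -> R, forall e : R, 0 < e -> exists2 r : R, 0 < r &
  forall h h', `|h| <= r -> `|h'| <= r ->
    `|F (z + h) - F (z + h') - \sum_j (h - h') 0 j * a j| <= e * `|h - h'|.
Proof.
move=> /expands_at_bounded[C [rho [C0 rho0 HC HF]]].
exists (fun j => \sum_(al <- degset d 2 | mdeg al == 1%N) (al j)%:R * c al).
(* The first bound gives [r / rho <= 1/2] for [natr_exp_half], the second makes the final constant
   [C * (2 * r / rho ^+ 2)] at most [e]. *)
move=> e e0; pose r := Num.min (rho / 2) (e * rho ^+ 2 / (2 * (C + 1))).
have C1 : 0 < C + 1 by rewrite ltr_wpDl.
have r0 : 0 < r by rewrite lt_min !divr_gt0 ?mulr_gt0 ?exprn_gt0.
have r2 : r <= rho / 2 by rewrite ge_min lexx.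
exists r => // h h' hr hr'.
have rr : r <= rho by apply: le_trans r2 _; move: rho0 => rho0'; lra.
have Fhh' : partial_sum (fun al => (monomial al h - monomial al h') * c al)
    @ totally --> F (z + h) - F (z + h').
  rewrite (_ : partial_sum _ = partial_sum (fun al => monomial al h * c al) \-
    partial_sum (fun al => monomial al h' * c al)); last first.
    apply/funext => S /=; rewrite !partial_sumE -sumrB.
    by apply: eq_bigr => al _; rewrite mulrBl.
  by apply: cvgB; apply: HF; exact: le_trans rr.
have <- : \sum_(al <- degset d 2) (monomial al h - monomial al h') * c al =
    \sum_j (h - h') 0 j *
      (\sum_(al <- degset d 2 | mdeg al == 1%N) (al j)%:R * c al).
  rewrite (bigID (fun al => mdeg al == 1%N))/= [X in _ + X]big1_fset; last first.
    move=> al; rewrite mem_degset => al2 al1.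
    have al0 : mdeg al = 0%N by case: (mdeg al) al1 al2 => [|[|]].
    by rewrite !monomial_deg0// subrr mul0r.
  rewrite addr0; under [RHS]eq_bigr do rewrite mulr_sumr.
  rewrite exchange_big/=; apply: eq_bigr => al /eqP al1.
  rewrite !monomial_deg1// -sumrB mulr_suml; apply: eq_bigr => j _.
  by rewrite !mxE; ring.
apply: (totally_dist_le Fhh') => S _.
apply: le_trans (ler_norm_sum _ _ _) _.
apply: (@le_trans _ _ (\sum_(al <- S | al \notin degset d 2)
    (`|c al| * rho ^+ mdeg al) * (2 * r / rho ^+ 2 * `|h - h'|))).
  apply: ler_sum => al; rewrite mem_degset -leqNgt => kal.
  rewrite normrM mulrC -mulrA ler_wpM2l// -(ler_pM2l r0).
  apply: le_trans (monomial_lipschitz al hr hr') _.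
  rewrite !mulrA ler_wpM2r//; move: (mdeg al) kal => [|[|k]]// _.
  have th : r / rho <= 2^-1 by rewrite ler_pdivrMr// mulrC.
  have th0 : 0 <= r / rho by rewrite divr_ge0// ltW.
  have := ler_wpM2l (mulr_ge0 (exprn_ge0 k.+2 (ltW rho0)) (sqr_ge0 (r / rho)))
    (natr_exp_half k th0 th).
  have -> : rho ^+ k.+2 * (r / rho) ^+ 2 * (k.+2%:R * (r / rho) ^+ k) =
      k.+2%:R * r ^+ k.+2.
    by rewrite !exprMn !exprVn !exprS; field; rewrite expf_neq0 gt_eqF.
  by move=> /le_trans; apply; rewrite exprMn exprVn; lra.
rewrite -mulr_suml mulrA ler_wpM2r//.
apply: (@le_trans _ _ (C * (2 * r / rho ^+ 2))).
  apply: ler_wpM2r.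
    by apply: divr_ge0; [apply: mulr_ge0 => //; exact: ltW|exact: sqr_ge0].
  apply: le_trans (HC S).
  by apply: ler_sum_cond => al; rewrite mulr_ge0 ?exprn_ge0 ?(ltW rho0).
have rho2 : 0 < rho ^+ 2 by rewrite exprn_gt0.
rewrite mulrA ler_pdivrMr// (le_trans (_ : _ <= (C + 1) * (2 * r)))//.
  by rewrite ler_wpM2r ?lerDl// mulr_ge0// ltW.
rewrite mulrA -ler_pdivlMl ?mulr_gt0// mulrC.
by rewrite ge_min [(C + 1) * 2]mulrC lexx orbT.
Qed.

End Expansion.

Lemma partial_sum_delta (R : realType) (I : choiceType) (a : I -> R) (i0 : I) :
  (forall i, i != i0 -> a i = 0) -> partial_sum a @ totally --> a i0.
Proof.
move=> H; apply/cvgrPdist_lt => e e0; exists [fset i0]%fset => // S /= iS.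
rewrite partial_sumE (sum_fsubset _ iS) big_seq_fset1 big1 ?addr0 ?subrr ?normr0//.
by move=> i; rewrite inE; exact: H.
Qed.

(** A linear form is continuous, hence passes through the convergence of the series; [s] is taken
    off the coefficient of the zero multi-index. *)
Lemma analytic_at_expands (R : realType) (d n : nat) (f : 'rV[R]_d -> 'rV[R]_n)
    (z : 'rV[R]_d) (v : 'I_n -> R) (s : R) : analytic_at f z ->
  exists c, expands_at (fun y => \sum_i f y 0 i * v i - s) z c.
Proof.
move=> [c Hc].
pose al0 : {ffun 'I_d -> nat} := [ffun=> 0%N].
exists (fun al => \sum_i c al 0 i * v i - (al == al0)%:R * s).
rewrite /expands_at; near=> y.
have cy : partial_sum (fun al => monomial al (y - z) *: c al) @ totally --> f y.
  by near: y.
have mono0 : monomial al0 (y - z) = 1.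
  by apply: monomial_deg0; rewrite /mdeg big1// => i _; rewrite ffunE.
have cs : partial_sum (fun al => monomial al (y - z) * ((al == al0)%:R * s))
    @ totally --> s.
  have := @partial_sum_delta R _
    (fun al => monomial al (y - z) * ((al == al0)%:R * s)) al0.
  by rewrite mono0 eqxx !mul1r; apply => al /negbTE ->; rewrite mul0r mulr0.
pose phi (x : 'rV[R]_n) : R := \sum_i x 0 i * v i.
have phi_cont : continuous phi.
  apply: continuous_big => [|i _ x]; first exact: add_continuous.
  exact: (cvgM (@coord_continuous R 1 n 0 i x) (cvg_cst _)).
have cphi : (fun S => phi (partial_sum (fun al => monomial al (y - z) *: c al) S))
    @ totally --> phi (f y).
  by apply: continuous_cvg => //; exact: phi_cont.
rewrite (_ : partial_sum _ = (fun S => phi (partial_sum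
  (fun al => monomial al (y - z) *: c al) S)) \- partial_sum (fun al =>
    monomial al (y - z) * ((al == al0)%:R * s))); first exact: cvgB.
apply/funext => S /=; rewrite !partial_sumE /phi.
have -> : partial_sum (fun al => monomial al (y - z) *: c al) S =
    \sum_(al <- S) monomial al (y - z) *: c al.
  by rewrite /partial_sum big_seq_fsetE.
under [X in _ = X - _]eq_bigr do rewrite summxE mulr_suml.
rewrite exchange_big -sumrB/=; apply: eq_bigr => al _.
rewrite mulrBr mulr_sumr; congr (_ - _); apply: eq_bigr => i _.
by rewrite mxE mulrA.
Unshelve. all: by end_near. Qed.

(* On a segment, the first point where [F] stops vanishing would be a zero of
   [F] that is neither isolated nor interior to the zero set. *)
Lemma ball_identity (R : realType) (d : nat) (F : 'rV[R]_d -> R)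
    (z q y : 'rV[R]_d) (r : R) :
  (forall x, `|x - z| < r -> exists c, expands_at F x c) ->
  `|q - z| < r -> (\forall x \near q, F x = 0) -> `|y - z| < r -> F y = 0.
Proof.
move=> HF qr Fq yr.
pose h (t : R) := F (q + t *: (y - q)).
have inB t : 0 <= t <= 1 -> `|q + t *: (y - q) - z| < r.
  move=> /andP[t0 t1].
  have -> : q + t *: (y - q) - z = (1 - t) *: (q - z) + t *: (y - z).
    by apply/rowP => i; rewrite !mxE; ring.
  apply: le_lt_trans (ler_normD _ _) _; rewrite !normrZ (ger0_norm t0).
  rewrite ger0_norm ?subr_ge0//.
  have [->|tn0] := eqVneq t 0; first by rewrite subr0 mul1r mul0r addr0.
  have : t * `|y - z| < t * r by rewrite ltr_pM2l// lt_def tn0.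
  have : (1 - t) * `|q - z| <= (1 - t) * r by rewrite ler_wpM2l ?subr_ge0// ltW.
  lra.
have dich t : 0 <= t <= 1 ->
    (exists2 e : R, 0 < e & forall s, `|s - t| < e -> h s = 0) \/
    (exists2 e : R, 0 < e & forall s, 0 < `|s - t| -> `|s - t| < e -> h s <> 0).
  move=> /inB /HF[c /(line_dichotomy (y - q))].
  have hE s : q + t *: (y - q) + (s - t) *: (y - q) = q + s *: (y - q).
    by apply/rowP => i; rewrite !mxE; ring.
  by case=> -[e e0 He]; [left|right]; exists e => // s; rewrite /h -hE; exact: He.
pose E : set R := [set t | 0 <= t <= 1 /\ forall s, 0 <= s <= t -> h s = 0].
have h0 : h 0 = 0 by rewrite /h scale0r addr0; exact: nbhs_singleton Fq.
have E0 : E 0.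
  split; first by rewrite lexx ler01.
  by move=> s /andP[a b]; rewrite (_ : s = 0)//; apply/eqP; rewrite eq_le b.
have Eub : ubound E 1 by move=> t [/andP[]].
have supE : has_sup E by split; [exists 0|exists 1].
have s0 : 0 <= sup E by apply: (sup_upper_bound supE).
have s1 : sup E <= 1 by apply: ge_sup; [exists 0|].
have hlt s : 0 <= s -> s < sup E -> h s = 0.
  move=> s00 /(sup_gt (proj1 supE) )[t [t01 Ht] st].
  by apply: Ht; rewrite s00 ltW.
(* In the first case the zeros continue past [sup E], so [sup E] is 1 and [y] is reached. The second
   is absurd: zeros accumulate at [sup E] from the left, or, if [sup E] is 0, near [q]. *)
have [[e e0 He]|[e e0 He]] := dich (sup E) (introT andP (conj s0 s1)).
  have hle s : 0 <= s -> s < sup E + e -> h s = 0.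
    move=> s00 se; have [/hlt->//|sl] := ltP s (sup E).
    by apply: He; rewrite ger0_norm ?subr_ge0// ltrBlDl.
  have [s1'|s1'] := ltP (sup E) 1; last first.
    have := hle 1 ler01; rewrite /h scale1r [q + _]addrC subrK; apply.
    by rewrite (lt_le_trans (_ : _ < 1 + e)) ?lerD2r// ltrDl.
  pose t := Num.min 1 (sup E + e / 2).
  have : E t.
    split; first by rewrite le_min ler01 ge_min lexx/= addr_ge0// divr_ge0// ltW.
    move=> s /andP[s00 st]; apply: hle => //; apply: le_lt_trans st _.
    by rewrite gt_min; apply/orP; right; lra.
  move=> /(sup_upper_bound supE); rewrite ge_min leNgt s1'/= => H.
  by exfalso; lra.
exfalso; have [sp|sle] := ltP 0 (sup E).
  pose m := Num.min e (sup E).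
  have m0 : 0 < m by rewrite lt_min e0.
  have me : m <= e by rewrite ge_min lexx.
  have ms : m <= sup E by rewrite ge_min lexx orbT.
  apply: (He (sup E - m / 2)); last (apply: hlt; lra).
    by rewrite addrAC subrr add0r normrN normr_gt0 gt_eqF// divr_gt0.
  by rewrite addrAC subrr add0r normrN gtr0_norm ?divr_gt0//; lra.
have sE0 : sup E = 0 by apply/eqP; rewrite eq_le sle.
move/nbhs_normP: Fq => [e' /= e'0 He'].
pose s := Num.min (e / 2) (e' / 2 / (`|y - q| + 1)).
have yq0 : 0 < `|y - q| + 1 by rewrite ltr_wpDl.
have sgt0 : 0 < s by rewrite lt_min !divr_gt0.
apply: (He s); rewrite ?sE0 ?subr0 ?normr_gt0 ?gt_eqF// ?gtr0_norm//.
  by rewrite gt_min; apply/orP; left; lra.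
apply: He'; rewrite /ball_/= opprD addNKr normrN normrZ gtr0_norm//.
have : s <= e' / 2 / (`|y - q| + 1) by rewrite ge_min lexx orbT.
by rewrite ler_pdivlMr// => H; have := normr_ge0 (y - q); nra.
Qed.

(** * Vector-valued analytic maps: strict derivative, continuity, Jacobian *)

Lemma analytic_at_strict (R : realType) (d n : nat)
    (f : 'rV[R]_d -> 'rV[R]_n) (z : 'rV[R]_d) : analytic_at f z ->
  exists A : 'M[R]_(d, n), forall e : R, 0 < e -> exists2 r : R, 0 < r &
    forall y y', `|y - z| <= r -> `|y' - z| <= r ->
      `|f y - f y' - (y - y') *m A| <= e * `|y - y'|.
Proof.
move=> fz.
have comp i : exists a : 'I_d -> R, forall e : R, 0 < e -> exists2 r : R, 0 < r &
    forall y y', `|y - z| <= r -> `|y' - z| <= r ->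
      `|f y 0 i - f y' 0 i - \sum_j (y - y') 0 j * a j| <= e * `|y - y'|.
  have [c Hc] := analytic_at_expands (fun k => (k == i)%:R) 0 fz.
  have [a Ha] := strict_differentiability Hc.
  exists a => e /Ha[r r0 Hr]; exists r => // y y' yr y'r.
  have fE x : \sum_k f x 0 k * (k == i)%:R - 0 = f x 0 i.
    rewrite subr0 (bigD1 i)//= eqxx mulr1 big1 ?addr0// => k /negbTE ->.
    by rewrite mulr0.
  have := Hr _ _ yr y'r; rewrite !fE ![z + _]addrC !subrK.
  by rewrite (_ : y - z - (y' - z) = y - y')// opprB addrA subrK.
have [a Ha] := boolp.choice comp.
exists (\matrix_(j, i) a i j) => e e0.
have /boolp.choice[r Hr] : forall i, exists r : R, 0 < r /\
    forall y y', `|y - z| <= r -> `|y' - z| <= r ->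
      `|f y 0 i - f y' 0 i - \sum_j (y - y') 0 j * a i j| <= e * `|y - y'|.
  by move=> i; have [r r0 Hr] := Ha i e e0; exists r.
have rnear : \forall t \near 0^'+, forall i, t <= r i.
  apply: filter_forall => i; apply: nbhs_right_le; have [] := Hr i; done.
near (0 : R)^'+ => t.
exists t => // y y' yt y't; apply: norm_le_coord => [|i].
  by rewrite mulr_ge0// ltW.
have /(_ i) tr : forall k, t <= r k by near: t.
have [_ /(_ y y' (le_trans yt tr) (le_trans y't tr))] := Hr i.
by rewrite !mxE; under eq_bigr do rewrite !mxE; under [in X in _ -> X]eq_bigr do rewrite !mxE.
Unshelve. all: by end_near. Qed.

Lemma norm_mulmx_bound (R : realType) (m n : nat) (A : 'M[R]_(m, n)) :
  exists2 K : R, 0 < K & forall u : 'rV[R]_m, `|u *m A| <= K * `|u|.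
Proof.
exists (1 + \sum_i \sum_j `|A i j|).
  by rewrite ltr_pwDl// sumr_ge0// => i _; exact: sumr_ge0.
move=> u; have S0 : 0 <= \sum_i \sum_j `|A i j|.
  by rewrite sumr_ge0// => i _; exact: sumr_ge0.
apply: norm_le_coord => [|j]; first by rewrite mulr_ge0// addr_ge0.
rewrite mxE; apply: le_trans (ler_norm_sum _ _ _) _.
apply: (@le_trans _ _ (\sum_i \sum_j `|A i j| * `|u|)).
  apply: ler_sum => i _; rewrite normrM mulrC (bigD1 j)//=.
  apply: ler_wpDr; first by apply: sumr_ge0 => k _; rewrite mulr_ge0.
  by rewrite ler_wpM2l// ler_norm_coord.
under eq_bigr do rewrite -mulr_suml.
by rewrite -mulr_suml ler_wpM2r// lerDr.
Qed.

Lemma metric_continuousP (R : realType) (V W : normedModType R) (f : V -> W)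
    (z : V) : {for z, continuous f} <->
  (forall e : R, 0 < e -> exists2 r : R, 0 < r &
    forall y, `|y - z| < r -> `|f y - f z| < e).
Proof.
split=> [/cvgrPdist_lt H e /H/nbhs_normP[r /= r0 Hr]|H].
  exists r => // y yz; rewrite distrC; apply: Hr.
  by rewrite /ball_/= distrC.
apply/cvgrPdist_lt => e /H[r r0 Hr]; apply/nbhs_normP; exists r => // y.
by rewrite /ball_/= distrC => /Hr; rewrite distrC.
Qed.

Lemma analytic_at_continuous (R : realType) (d n : nat)
    (f : 'rV[R]_d -> 'rV[R]_n) (z : 'rV[R]_d) : analytic_at f z ->
  {for z, continuous f}.
Proof.
move=> /analytic_at_strict[A /(_ 1 ltr01)[r r0 Hr]].
have [K K0 HK] := norm_mulmx_bound A.
apply/metric_continuousP => e e0.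
exists (Num.min r (e / (K + 1))); first by rewrite lt_min r0 divr_gt0// addr_gt0.
move=> y; rewrite lt_min => /andP[/ltW yr yz].
have zr : `|z - z| <= r by rewrite subrr normr0 ltW.
have := Hr _ _ yr zr; rewrite mul1r => H.
rewrite -(subrK ((y - z) *m A) (f y - f z)).
apply: le_lt_trans (ler_normD _ _) _.
move: yz; rewrite ltr_pdivlMr ?addr_gt0// => yz.
by have := HK (y - z); nra.
Qed.

(** Ties the matrix read off the power series to the Jacobian in which the immersion condition is
    phrased. *)
Lemma strict_jacobian (R : realType) (d n : nat)
    (f : 'rV[R]_d -> 'rV[R]_n) (z : 'rV[R]_d) (A : 'M[R]_(d, n)) :
  (forall e : R, 0 < e -> exists2 r : R, 0 < r &
    forall y y', `|y - z| <= r -> `|y' - z| <= r ->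
      `|f y - f y' - (y - y') *m A| <= e * `|y - y'|) ->
  'J f z = A.
Proof.
move=> HA.
have dfE : 'd f z = mulmxr A :> ('rV[R]_d -> 'rV[R]_n).
  apply: diff_unique.
    move=> y; have [K K0 HK] := norm_mulmx_bound A.
    apply/metric_continuousP => e e0; exists (e / K); first exact: divr_gt0.
    move=> x xy; rewrite /= -mulmxBl; apply: le_lt_trans (HK _) _.
    by rewrite mulrC -ltr_pdivlMr.
  apply/eqaddoP => e e0; have [r r0 Hr] := HA e e0.
  apply/(nbhs_normP (0 : 'rV[R]_d)); exists r => // h; rewrite /ball_/= sub0r normrN => /ltW h_r.
  rewrite !fctE /= opprD addrA.
  have hr : `|h + z - z| <= r by rewrite addrK.
  have zr : `|z - z| <= r by rewrite subrr normr0 ltW.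
  by have := Hr _ _ hr zr; rewrite addrK.
by rewrite /jacobian; apply/row_matrixP => i; rewrite rowE mul_rV_lin1 dfE/= -rowE.
Qed.

(** * Planar pieces and rational charts of the manifold *)

(** Clearing denominators brings every rational hyperplane to this form, whose data [(v, s)] range
    over a countable type. *)
Definition integral_hyperplane (R : realType) (n : nat) (v : 'rV[int]_n)
    (s : int) : set 'rV[R]_n :=
  [set x | \sum_i x 0 i * (v 0 i)%:~R = s%:~R].

(** The points of [M] near which [M] lies in [H] form a relatively open subset; by [ball_identity]
    in a chart it is also relatively closed, so one such point would put all of [M] in [H]. *)
Lemma no_planar_piece (R : realType) (n d : nat) (M : set 'rV[R]_n)
    (v : 'rV[int]_n) (s : int) (p : 'rV[R]_n) (O : set 'rV[R]_n) :
  analytic_submanifold d M -> connected M ->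
  (forall H : set 'rV[R]_n, rational_affine_hyperplane H -> ~ M `<=` H) ->
  v != 0 -> M p -> open O -> O p -> ~ M `&` O `<=` integral_hyperplane v s.
Proof.
move=> hM hMc hMH v0 Mp oO Op MO; pose H : set 'rV[R]_n := integral_hyperplane v s.
pose planar x := exists U : set 'rV[R]_n, [/\ open U, U x & M `&` U `<=` H].
have pH x : M x -> planar x -> H x by move=> Mx [U [_ Ux]]; apply.
suff allM : M `&` planar = M.
  apply: (hMH H); first by exists v, s%:~R; split => //; rewrite ratr_int.
  by move=> x Mx; apply: pH => //; rewrite -allM in Mx; case: Mx.
apply: hMc; first by exists p; split => //; exists O.
  exists planar => //; rewrite openE => x [U [oU Ux MU]].
  rewrite /interior nbhsE; exists U => // y Uy.
  by exists U.
exists (closure (M `&` planar)); first exact: closed_closure.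
apply/seteqP; split=> x [Mx]; first by move=> Px; split=> //; exact: subset_closure.
move=> clx; split=> //.
have [U [W [f [g [Ux [[oU oW] fan _ [fW gK] gcont]]]]]] := hM x Mx.
have [y0 Wy0 fy0] : (f @` W) x by rewrite fW.
have gx : g x = y0 by rewrite -fy0 gK.
have : nbhs y0 W by exact: open_nbhs_nbhs.
move=> /nbhs_normP[r /= r0 Wr].
have Wr' y : `|y - y0| < r -> W y by move=> yr; apply: Wr; rewrite /ball_/= distrC.
(* Continuity of [g] sends points of [M] near [x] into the parameter ball about [y0]; a planar point
   [q] among them makes [F] vanish on that ball, hence on a neighbourhood of [x] in [M]. *)
have gB : \forall y \near x, (M `&` U) y -> `|g y - y0| < r.
  move/subspace_continuousP: gcont => /(_ x (conj Mx Ux)).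
  move=> /cvgrPdist_lt/(_ _ r0); rewrite near_withinE.
  by apply: filterS => y H1 /H1; rewrite /from_subspace gx distrC.
have : nbhs x (U `&` [set y | (M `&` U) y -> `|g y - y0| < r]).
  by apply: filterI => //; exact: open_nbhs_nbhs.
rewrite nbhsE; case=> O1 [oO1 O1x] O1s.
have [q [[Mq [Uq [oUq Uqq MUq]]] O1q]] := clx _ (open_nbhs_nbhs (conj oO1 O1x)).
have [Uq' /(_ (conj Mq (proj1 (O1s _ O1q)))) gq] := O1s _ O1q.
have [y1 Wy1 fy1] : (f @` W) q by rewrite fW.
have gq1 : g q = y1 by rewrite -fy1 gK.
pose F y := \sum_i f y 0 i * (v 0 i)%:~R - s%:~R.
have Fy1 : \forall y \near y1, F y = 0.
  have nW : nbhs y1 W by exact: open_nbhs_nbhs.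
  have nU : nbhs y1 (f @^-1` Uq).
    by apply: (analytic_at_continuous (fan _ Wy1)); rewrite fy1; exact: open_nbhs_nbhs.
  apply: filterS2 nW nU => y Wy Uy; apply/eqP; rewrite subr_eq0; apply/eqP.
  apply: MUq; split => //.
  by have : (f @` W) (f y) by [exists y]; rewrite fW => -[].
have F0 y : `|y - y0| < r -> F y = 0.
  apply: (@ball_identity R d F y0 y1 y r) => //; last by rewrite -gq1.
  by move=> w /Wr' /fan; exact: analytic_at_expands.
exists O1; split => // w [Mw O1w]; have [Uw /(_ (conj Mw Uw)) gw] := O1s _ O1w.
have [yw Wyw fyw] : (f @` W) w by rewrite fW.
move: gw; rewrite -fyw gK// => /F0 /eqP; rewrite subr_eq0 => /eqP; apply.
Qed.

(** Makes row vectors a complete normed module, as the fixed point theorem and the nested balls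
    require. *)
HB.instance Definition _ (R : realType) (m n : nat) := Complete.on 'M[R]_(m, n).

(** Newton iteration with the derivative frozen at [z]: with error [(2 * K)^-1], where [K] bounds
    [invmx A], the map [T] below contracts by 1/2, and its fixed points solve [Phi y = w]. *)
Lemma local_inversion (R : realType) (d : nat) (Phi : 'rV[R]_d -> 'rV[R]_d)
    (z : 'rV[R]_d) (A : 'M[R]_d) : A \in unitmx ->
  (forall e : R, 0 < e -> exists2 r : R, 0 < r &
    forall y y', `|y - z| <= r -> `|y' - z| <= r ->
      `|Phi y - Phi y' - (y - y') *m A| <= e * `|y - y'|) ->
  exists r K : R, [/\ 0 < r, 0 < K,
    forall y y', `|y - z| <= r -> `|y' - z| <= r ->
      `|y - y'| <= K * `|Phi y - Phi y'|
    & forall x w rho, 0 < rho -> `|x - z| + rho <= r ->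
      `|w - Phi x| <= rho / K -> exists2 y, `|y - x| <= rho & Phi y = w].
Proof.
move=> uA HA; have [K K0 HK] := norm_mulmx_bound (invmx A).
have e0 : 0 < (2 * K)^-1 by rewrite invr_gt0 mulr_gt0.
have [r r0 Hr] := HA _ e0.
have half y y' : `|y - z| <= r -> `|y' - z| <= r ->
    `|(y - y') - (Phi y - Phi y') *m invmx A| <= 2^-1 * `|y - y'|.
  move=> yr y'r; have H := Hr _ _ yr y'r.
  rewrite -normrN opprB -[y - y' in X in X <= _](mulmxK uA) -mulmxBl.
  apply: le_trans (HK _) _; apply: le_trans (ler_wpM2l (ltW K0) H) _.
  by rewrite mulrA invfM mulrCA mulfV ?mulr1 ?gt_eqF.
have K20 : 0 < 2 * K by rewrite mulr_gt0.
exists r, (2 * K); split=> // [y y' yr y'r|x w rho rho0 xr wx].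
  have H := half _ _ yr y'r; have H2 := HK (Phi y - Phi y').
  have := ler_normD ((y - y') - (Phi y - Phi y') *m invmx A)
    ((Phi y - Phi y') *m invmx A).
  by rewrite subrK; lra.
pose U : set 'rV[R]_d := [set y | `|y - x| <= rho].
pose T y := y - (Phi y - w) *m invmx A.
have UE : U = closed_ball x rho.
  rewrite closed_ballE//; apply/seteqP.
  by split=> y; rewrite /U/closed_ball_/= distrC.
have Uz y : U y -> `|y - z| <= r.
  move=> Uy; apply: le_trans xr; rewrite -(subrKA x) addrC.
  by apply: le_trans (ler_normD _ _) _; rewrite lerD2l.
have xx : U x by rewrite /U/= subrr normr0 ltW.
have contr y y' : U y -> U y' -> `|T y - T y'| <= 2^-1 * `|y - y'|.
  move=> /Uz yr /Uz y'r.
  have -> : T y - T y' = (y - y') - (Phi y - Phi y') *m invmx A.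
    rewrite /T opprB !mulmxBl; set a := Phi y *m _; set b := Phi y' *m _.
    by set c := w *m _; apply/rowP => i; rewrite !mxE; ring.
  exact: half.
have TU : set_fun U U T.
  move=> y Uy; rewrite /U/=.
  have := contr _ _ Uy xx; have : `|T x - x| <= rho / 2.
    rewrite /T addrAC subrr add0r normrN; apply: le_trans (HK _) _.
    rewrite distrC; apply: le_trans (ler_wpM2l (ltW K0) wx) _.
    have -> : K * (rho / (2 * K)) = rho / 2 by field; rewrite gt_eqF.
    by [].
  have := ler_normD (T y - T x) (T x - x); rewrite subrKA.
  by move: Uy; rewrite /U/=; lra.
have := @banach_fixed_point R 'rV[R]_d U (mkfun_fun TU).
case.
- exists (2^-1)%:nng; split; first by rewrite /=; lra.
  by move=> [y y'] [/= Uy Uy']; exact: contr.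
- by rewrite UE; exact: closed_ball_closed.
- by exists x.
move=> y Uy; rewrite /= /mkfun/= /T => yE; exists y => //.
have /(congr1 (mulmx^~ A)) : (Phi y - w) *m invmx A = 0.
  by rewrite -[LHS](subKr y) -yE subrr.
by rewrite mulmxKV// mul0mx => /eqP; rewrite subr_eq0 => /eqP.
Qed.

Lemma common_denominator (T : finType) (q : T -> rat) :
  exists (N : int) (b : T -> int), 0 < N /\ forall j, (b j)%:~R = N%:~R * q j.
Proof.
exists (\prod_j denq (q j)), (fun j => numq (q j) * \prod_(i | i != j) denq (q i)).
split=> [|j]; first by apply: prodr_gt0 => j _; exact: denq_gt0.
rewrite intrM [in RHS](bigD1 j)//= intrM mulrAC; congr (_ * _).
by rewrite mulrC -{2}(divq_num_den (q j)) divfK// intq_eq0 denq_neq0.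
Qed.

Lemma rat_row_dense (R : realType) (d : nat) (u : 'rV[R]_d) (e : R) : 0 < e ->
  exists w : 'rV[rat]_d, `|map_mx ratr w - u| <= e.
Proof.
move=> e0; have H j : exists q : rat, `|ratr q - u 0 j| <= e.
  have [|q] := @rat_in_itvoo R (u 0 j - e) (u 0 j + e); first lra.
  rewrite in_itv/= => /andP[a b]; exists q.
  by rewrite ler_norml; apply/andP; split; lra.
have [w Hw] := boolp.choice H; exists (\row_j w j).
by apply: norm_le_coord => [|j]; rewrite ?mxE// ltW.
Qed.

(* Any rational line in the coordinates selected by [c] lies in a hyperplane
   with integer coefficients: take a rational normal orthogonal to its
   direction and clear denominators. *)
Lemma hyperplane_through_line (R : realType) (n d : nat) (c : 'I_d -> 'I_n)
    (w u : 'rV[rat]_d) : (2 <= d)%N -> injective c ->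
  exists (v : 'rV[int]_n) (s : int), v != 0 /\
    forall (x : 'rV[R]_n) (t : R),
      (forall j, x 0 (c j) = ratr (w 0 j) + t * ratr (u 0 j)) ->
      integral_hyperplane v s x.
Proof.
move=> d2 cinj.
have [a a0 au] : exists2 a : 'rV[rat]_d, a != 0 & \sum_j a 0 j * u 0 j = 0.
  have /rowV0Pn[a /sub_kermxP au a0] : kermx u^T != 0.
    rewrite -mxrank_eq0 mxrank_ker subn_eq0 -ltnNge.
    by apply: leq_ltn_trans d2; exact: rank_leq_col.
  exists a => //; have /matrixP/(_ 0 0) := au; rewrite !mxE => au0; rewrite -[RHS]au0.
  by apply: eq_bigr => j _; rewrite !mxE.
(* The index [None] carries the constant term, so one denominator clears it together with the
   coefficients. *)
pose q (o : option 'I_d) := if o is Some j then a 0 j else \sum_j a 0 j * w 0 j.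
have [N [b [N0 bE]]] := common_denominator q.
pose v : 'rV[int]_n := \row_i \sum_(j | c j == i) b (Some j).
have vc j : v 0 (c j) = b (Some j).
  rewrite mxE (bigD1 j)//= big1 ?addr0// => k /andP[/eqP/cinj ->].
  by rewrite eqxx.
exists v, (b None); split.
  have /rV0Pn[j aj] := a0; apply/rV0Pn; exists (c j); rewrite vc.
  by rewrite -(intr_eq0 rat) bE mulf_neq0// intr_eq0 gt_eqF.
move=> x t xE; rewrite /integral_hyperplane/=.
have -> : \sum_i x 0 i * (v 0 i)%:~R =
    \sum_j x 0 (c j) * (b (Some j))%:~R :> R.
  under eq_bigr do rewrite mxE rmorph_sum mulr_sumr/=.
  rewrite (exchange_big_dep predT)//=; apply: eq_bigr => j _.
  by rewrite (big_pred1 (c j))// => i; rewrite /= eq_sym.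
have bR o : (b o)%:~R = N%:~R * ratr (q o) :> R.
  by rewrite -(ratr_int R (b o)) bE rmorphM/= ratr_int.
under eq_bigr do rewrite xE bR/= mulrDl.
rewrite big_split/= bR/= rmorph_sum/= mulr_sumr.
rewrite [X in _ + X](_ : _ = N%:~R * t * ratr (\sum_j a 0 j * u 0 j)).
  by rewrite au rmorph0 mulr0 addr0; apply: eq_bigr => j _; rewrite rmorphM/=; ring.
by rewrite rmorph_sum mulr_sumr; apply: eq_bigr => j _; rewrite rmorphM/=; ring.
Qed.

(* Near [z0] the coordinates of [f] selected by [c] form a bi-Lipschitz open
   map, so they can be used as a chart in which rationality makes sense. *)
Record rational_chart (R : realType) (n d : nat) (M : set 'rV[R]_n)
    (f : 'rV[R]_d -> 'rV[R]_n) (c : 'I_d -> 'I_n) (z0 : 'rV[R]_d) (r K : R) :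
    Prop := RationalChart {
  chart_inj : injective c;
  chart_radius : 0 < r;
  chart_const : 0 < K;
  chart_analytic : forall y, `|y - z0| <= r -> analytic_at f y;
  chart_image : forall y, `|y - z0| <= r -> M (f y);
  chart_expanding : forall y y', `|y - z0| <= r -> `|y' - z0| <= r ->
    `|y - y'| <= K * `|colsub c (f y) - colsub c (f y')|;
  chart_open : forall x w rho, 0 < rho -> `|x - z0| + rho <= r ->
    `|w - colsub c (f x)| <= rho / K ->
    exists2 y, `|y - x| <= rho & colsub c (f y) = w;
  chart_nonplanar : forall (v : 'rV[int]_n) (s : int) z, v != 0 ->
    `|z - z0| <= r -> ~ (\forall y \near z, integral_hyperplane v s (f y)) }.

Lemma colsub_mulmx (R : realType) (m n d : nat) (c : 'I_d -> 'I_n)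
    (u : 'rV[R]_m) (A : 'M[R]_(m, n)) : colsub c (u *m A) = u *m colsub c A.
Proof. by apply/rowP => j; rewrite !mxE; apply: eq_bigr => i _; rewrite mxE. Qed.

Lemma norm_colsub (R : realType) (n d : nat) (c : 'I_d -> 'I_n)
    (u : 'rV[R]_n) : `|colsub c u| <= `|u|.
Proof. by apply: norm_le_coord => // j; rewrite mxE ler_norm_coord. Qed.

Lemma strict_colsub (R : realType) (n d : nat) (f : 'rV[R]_d -> 'rV[R]_n)
    (c : 'I_d -> 'I_n) (z : 'rV[R]_d) (A : 'M[R]_(d, n)) :
  (forall e : R, 0 < e -> exists2 r : R, 0 < r &
    forall y y', `|y - z| <= r -> `|y' - z| <= r ->
      `|f y - f y' - (y - y') *m A| <= e * `|y - y'|) ->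
  forall e : R, 0 < e -> exists2 r : R, 0 < r &
    forall y y', `|y - z| <= r -> `|y' - z| <= r ->
      `|colsub c (f y) - colsub c (f y') - (y - y') *m colsub c A|
        <= e * `|y - y'|.
Proof.
move=> HA e /HA[r r0 Hr]; exists r => // y y' yr y'r.
apply: le_trans (Hr y y' yr y'r); rewrite -colsub_mulmx.
by apply: le_trans (norm_colsub c _); rewrite !raddfB.
Qed.

(** The Jacobian has rank [d], so [d] of its columns are independent; local inversion applies to the
    corresponding coordinates of [f]. *)
Lemma rational_chart_exists (R : realType) (n d : nat) (M : set 'rV[R]_n) :
  analytic_submanifold d M -> connected M ->
  (forall H : set 'rV[R]_n, rational_affine_hyperplane H -> ~ M `<=` H) ->
  M !=set0 -> exists f c z0 r K, @rational_chart R n d M f c z0 r K.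
Proof.
move=> hM hMc hMH [p Mp].
have [U [W [f [g [Up [[oU oW] fan rkJ [fW gK] gcont]]]]]] := hM p Mp.
have [z0 Wz0 fz0] : (f @` W) p by rewrite fW.
have : nbhs z0 W by exact: open_nbhs_nbhs.
move=> /nbhs_normP[r2 /= r20 Wr].
have Wr' y : `|y - z0| < r2 -> W y by move=> yr; apply: Wr; rewrite /ball_/= distrC.
have MU y : W y -> (M `&` U) (f y) by move=> Wy; rewrite -fW; exists y.
have [A HA] := analytic_at_strict (fan _ Wz0).
have rkA : row_full A^T by rewrite /row_full mxrank_tr -(strict_jacobian HA) rkJ.
pose c : 'I_d -> 'I_n := fullrankfun rkA.
have uA : colsub c A \in unitmx.
  by rewrite -unitmx_tr trmx_mxsub; exact: fullrowsub_unit.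
have [r1 [K [r10 K0 Hexp Hopen]]] := local_inversion uA (strict_colsub c HA).
have r0 : 0 < Num.min r1 (r2 / 2) by rewrite lt_min r10 divr_gt0.
have rr1 (a : R) : a <= Num.min r1 (r2 / 2) -> a <= r1.
  by move=> /le_trans; apply; rewrite ge_min lexx.
have rW y : `|y - z0| <= Num.min r1 (r2 / 2) -> W y.
  by rewrite le_min => /andP[_ y2]; apply: Wr'; lra.
exists f, c, z0, (Num.min r1 (r2 / 2)), K; split=> //.
- exact: fullrankfun_inj.
- by move=> y /rW /fan.
- by move=> y /rW /MU[].
- by move=> y y' /rr1 yr /rr1 y'r; exact: Hexp.
- by move=> x w rho rho0 /rr1 xr; exact: Hopen.
move=> v s z v0 /rW Wz near_z.
have [Mfz Ufz] := MU _ Wz.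
(* Continuity of [g] turns planarity on a parameter neighbourhood of [z] into planarity on a
   neighbourhood of [f z] in [M]. *)
have : \forall x \near f z, (M `&` U) x -> integral_hyperplane v s x.
  move/subspace_continuousP: gcont => /(_ (f z) (conj Mfz Ufz)).
  have gz : g (f z) = z by exact: gK.
  rewrite /from_subspace gz => /(_ _ near_z).
  move=> H; have {H} : \forall x \near f z, (M `&` U) x ->
    integral_hyperplane v s (f (g x)) := H.
  apply: filterS => x Hx MUx; have := Hx MUx.
  by move: MUx; rewrite -fW => -[y Wy <-]; rewrite gK.
rewrite /prop_near1 nbhsE; case=> O [oO Oz] HO.
apply: (no_planar_piece (O := O `&` U) hM hMc hMH v0 Mfz) => //.
  exact: openI.
by move=> x [Mx [Ox Ux]]; exact: HO.
Qed.

(** The direction [u] precedes [e]: the next hyperplane, and the time from which it approximates,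
    must be fixed before deciding how close to [z] to stay. It is a rational approximation of the
    image, under the derivative of the selected coordinates, of a direction in the cone. *)
Lemma rational_escape (R : realType) (n d : nat) (M : set 'rV[R]_n) f c
    (z0 : 'rV[R]_d) (r K : R) (z : 'rV[R]_d) (v : 'rV[int]_n) (s : int) :
  rational_chart M f c z0 r K -> `|z - z0| < r -> v != 0 ->
  exists u : 'rV[rat]_d, forall e : R, 0 < e -> exists (y : 'rV[R]_d) (t : rat),
    [/\ `|y - z| <= e,
      colsub c (f y) = colsub c (f z) + ratr t *: map_mx ratr u
    & ~ integral_hyperplane v s (f y)].
Proof.
move=> ch zr v0; have K0 := chart_const ch.
have fz := chart_analytic ch (ltW zr).
have [cf Hcf] := analytic_at_expands (fun i => (v 0 i)%:~R) s%:~R fz.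
have nzF : ~ \forall y \near z,
    \sum_i f y 0 i * (v 0 i)%:~R - s%:~R = 0.
  move=> nF; apply: (chart_nonplanar ch v0 (ltW zr) (s := s)).
  by apply: filterS nF => y /eqP; rewrite subr_eq0 => /eqP.
have [u [e1 [e10 cone]]] := nonvanishing_cone Hcf nzF.
have [A HA] := analytic_at_strict fz.
have u10 : 0 < `|u| + 1 by rewrite ltr_wpDl.
have eta0 : 0 < e1 / (2 * K * (`|u| + 1)).
  by apply: divr_gt0 => //; apply: mulr_gt0 => //; exact: mulr_gt0.
have [r1 r10 Hr1] := strict_colsub c HA eta0.
have [|uq Huq] := @rat_row_dense R d (u *m colsub c A) (e1 / (2 * K)).
  by rewrite divr_gt0// mulr_gt0.
exists uq => e e0; set uR := map_mx ratr uq in Huq *.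
have uR10 : 0 < `|uR| + 1 by rewrite ltr_wpDl.
have rho0 : 0 < r - `|z - z0| by rewrite subr_gt0.
(* In order: the cone, the strict derivative at [z], closeness [e] of [y], [z + t *: u] inside the
   chart, and solvability of the coordinate equation for [y]. *)
pose tmax := Num.min (Num.min e1 (r1 / (`|u| + 1)))
  (Num.min (e / (`|u| + 1 + e1)) (Num.min ((r - `|z - z0|) / (`|u| + 1))
    ((r - `|z - z0|) / K / (`|uR| + 1)))).
have ue0 : 0 < `|u| + 1 + e1 by rewrite addr_gt0.
have tmax0 : 0 < tmax by rewrite !lt_min e10 !divr_gt0.
have [tq] := @rat_in_itvoo R 0 tmax tmax0; rewrite in_itv/= => /andP[].
set t : R := ratr tq => t0 /ltW; rewrite !le_min => /andP[/andP[te1]].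
rewrite !ler_pdivlMr// => tr1 /and3P[te tz tu].
have [||y yz yE] := chart_open ch (x := z) (rho := r - `|z - z0|)
    (w := colsub c (f z) + t *: uR) rho0.
  by rewrite addrC subrK.
  rewrite addrC addKr normrZ gtr0_norm// ler_pdivlMr//.
  by apply: le_trans tu; rewrite ler_wpM2r ?(ltW K0)// ler_wpM2l ?(ltW t0)// lerDl.
pose zt := z + t *: u.
have ztz : `|zt - z| = t * `|u| by rewrite /zt addrC addKr normrZ gtr0_norm.
have tu1 : t * `|u| <= t * (`|u| + 1) by rewrite ler_wpM2l ?(ltW t0)// lerDl.
have rin x : `|x - z| <= r - `|z - z0| -> `|x - z0| <= r.
  move=> xz; rewrite -(subrKA z); apply: le_trans (ler_normD _ _) _.
  by move: xz; lra.
have ztr : `|zt - z0| <= r by apply: rin; rewrite ztz; exact: le_trans tz.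
(* [y] is within [t * e1] of [z + t *: u], hence in the cone: half of the error comes from the
   rational approximation of the direction, half from linearising [f]. *)
have yzt : `|y - zt| <= t * e1.
  apply: le_trans (chart_expanding ch (rin _ yz) ztr) _.
  have zr1 : `|z - z| <= r1 by rewrite subrr normr0 ltW.
  have ztr1 : `|zt - z| <= r1 by rewrite ztz; exact: le_trans tr1.
  have H1 := Hr1 _ _ ztr1 zr1.
  have -> : colsub c (f y) - colsub c (f zt) = t *: (uR - u *m colsub c A) -
      (colsub c (f zt) - colsub c (f z) - (zt - z) *m colsub c A).
    rewrite yE (_ : zt - z = t *: u); last by rewrite /zt addrC addKr.
    by rewrite -scalemxAl; apply/rowP => j; rewrite !mxE; ring.
  rewrite mulrC -ler_pdivlMr//; apply: le_trans (ler_normB _ _) _.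
  rewrite normrZ gtr0_norm//.
  have H2 := ler_wpM2l (ltW t0) Huq.
  have H3 : e1 / (2 * K * (`|u| + 1)) * `|zt - z| <= t * (e1 / (2 * K)).
    rewrite ztz (_ : e1 / (2 * K * (`|u| + 1)) * (t * `|u|) =
      t * (e1 / (2 * K)) * (`|u| / (`|u| + 1))); last first.
      by field; rewrite !gt_eqF.
    apply: ler_piMr; last by rewrite ler_pdivrMr// mul1r lerDl.
    by apply: ltW; apply: mulr_gt0 => //; apply: divr_gt0 => //; exact: mulr_gt0.
  have -> : t * e1 / K = t * (e1 / (2 * K)) + t * (e1 / (2 * K)).
    by field; rewrite gt_eqF.
  by apply: lerD => //; exact: le_trans H3.
exists y, tq; split=> //.
  rewrite -(subrKA zt); apply: le_trans (ler_normD _ _) _; rewrite ztz.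
  by apply: le_trans te; lra.
have yE' : y = z + t *: (t^-1 *: (y - z)).
  by rewrite scalerA mulfV ?gt_eqF// scale1r addrC subrK.
move=> Hy; apply: (cone t (t^-1 *: (y - z)) t0 te1); last first.
  by rewrite -yE'; apply/eqP; rewrite subr_eq0; apply/eqP.
have -> : t^-1 *: (y - z) - u = t^-1 *: (y - zt).
  by rewrite /zt opprD addrA [in RHS]scalerBr scalerA mulVf ?gt_eqF// scale1r.
rewrite normrZ gtr0_norm ?invr_gt0// mulrC ler_pdivrMr//.
by rewrite mulrC.
Qed.

(** * The nested construction *)

Lemma nested_balls (R : realType) (V : completeNormedModType R)
    (z : nat -> V) (rho : nat -> R) :
  (forall k, 0 <= rho k <= k.+1%:R^-1) ->
  (forall k, `|z k.+1 - z k| + rho k.+1 <= rho k) ->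
  exists y, forall k, `|y - z k| <= rho k.
Proof.
move=> Hrho Hz.
have Hzm k m : `|z (k + m)%N - z k| + rho (k + m)%N <= rho k.
  elim: m => [|m IH]; first by rewrite addn0 subrr normr0 add0r.
  rewrite addnS; have := Hz (k + m)%N.
  by have := ler_normD (z (k + m).+1 - z (k + m)%N) (z (k + m)%N - z k);
    rewrite subrKA; lra.
have zk k m : (k <= m)%N -> `|z m - z k| <= rho k.
  move=> /subnKC <-; have := Hzm k (m - k)%N.
  by have /andP[] := Hrho (k + (m - k))%N; lra.
have small (e : R) : 0 < e -> exists k, rho k < e.
  move=> e0; exists (Num.trunc e^-1); have /andP[_ h] := Hrho (Num.trunc e^-1).
  apply: le_lt_trans h _; rewrite -[ltRHS]invrK ltf_pV2 ?posrE ?invr_gt0//.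
  exact: truncnS_gt.
have cvgz : cvgn z.
  apply: cauchy_cvg; apply: cauchy_exP => e e0; have [k ke] := small e e0.
  exists (z k); exists k => // m /= km; rewrite -ball_normE/= distrC.
  exact: le_lt_trans (zk _ _ km) ke.
exists (limn z) => k; apply/ler_addgt0Pr => e e0.
have /cvgrPdist_lt/(_ e e0)[N _ HN] : z @ \oo --> limn z by exact: cvgz.
have h1 := HN (maxn N k) (leq_maxl _ _); have h2 := zk k _ (leq_maxr N k).
have := ler_normD (limn z - z (maxn N k)) (z (maxn N k) - z k).
by move: h1 => /=; rewrite subrKA; lra.
Qed.

Lemma integral_totally_irrational (R : realType) (n : nat) (x : 'rV[R]_n) :
  (forall (v : 'rV[int]_n) (s : int), v != 0 -> ~ integral_hyperplane v s x) ->
  totally_irrational x.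
Proof.
move=> Hx a0 a; rewrite mulr1 => a_rel.
have a_eq0 i : a i = 0.
  apply: contrapT => /eqP ai; pose q (o : option 'I_n) := oapp a a0 o.
  have [N [b [N0 bE]]] := common_denominator q.
  have bR o : (b o)%:~R = N%:~R * ratr (q o) :> R.
    by rewrite -(ratr_int R (b o)) bE rmorphM/= ratr_int.
  apply: (Hx (\row_j b (Some j)) (- b None)).
    apply/rV0Pn; exists i.
    by rewrite mxE -(intr_eq0 rat) bE mulf_neq0// intr_eq0 gt_eqF.
  rewrite /integral_hyperplane/= mulrNz bR/=.
  have -> : \sum_j x 0 j * ((\row_k b (Some k)) 0 j)%:~R =
      N%:~R * (\sum_j ratr (a j) * x 0 j) :> R.
    by rewrite mulr_sumr; apply: eq_bigr => j _; rewrite mxE bR/=; ring.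
  by rewrite -mulrN; congr (_ * _); apply/eqP; rewrite -addr_eq0 addrC a_rel.
split=> //; move: a_rel; rewrite big1 => [|i _]; last by rewrite a_eq0 rmorph0 mul0r.
by rewrite addr0 => /eqP; rewrite fmorph_eq0 => /eqP.
Qed.

Section Iteration.
Variables (R : realType) (n d : nat) (M : set 'rV[R]_n) (r : 'I_n -> R).
Variables (f : 'rV[R]_d -> 'rV[R]_n) (c : 'I_d -> 'I_n) (z0 : 'rV[R]_d).
Variables (rad K : R).
Hypotheses (d_ge2 : (2 <= d)%N) (r_gt0 : forall i, 0 < r i)
  (r_sum1 : \sum_i r i = 1) (chart : rational_chart M f c z0 rad K).

(** All pairs [(v, s)] are enumerated by [unpickle]; an index that decodes to nothing, or to
    [v = 0], imposes no condition. *)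
Definition avoids (k : nat) (x : 'rV[R]_n) : Prop :=
  forall (v : 'rV[int]_n) (s : int),
    choice.unpickle k = Some (v, s) -> v != 0 -> ~ integral_hyperplane v s x.

(* A triple [(z, rho, T)]: the ball of centre [z] and radius [rho] is what is
   left of the search, and [T] the time up to which singularity is secured. *)
Definition stage (k : nat) (st : 'rV[R]_d * R * R) : Prop :=
  let: (z, rho, T) := st in
  [/\ 0 < rho <= k.+1%:R^-1, `|z - z0| + rho <= rad,
      exists w : 'rV[rat]_d, colsub c (f z) = map_mx ratr w, 0 < T
    & forall t, T <= t -> approximable r (k.+1%:R^-1 / 2) t (f z)].

(** The conditions hold on the whole new ball and so pass to the limit point; the increment 1 drives
    the times to infinity. *)
Definition refines (k : nat) (st st' : 'rV[R]_d * R * R) : Prop :=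
  let: (z, rho, T) := st in let: (z', rho', T') := st' in
  [/\ `|z' - z| + rho' <= rho, T + 1 <= T'
    & forall y, `|y - z'| <= rho' -> avoids k (f y) /\
        forall t, T <= t <= T' -> approximable r k.+1%:R^-1 t (f y)].

(** One [T0] serves all points over the rational line, since a single hyperplane contains them;
    [t = 0] gives [z] itself. *)
Lemma hyperplane_rational_point (z : 'rV[R]_d) (w u : 'rV[rat]_d) (delta : R) :
  0 < delta -> colsub c (f z) = map_mx ratr w ->
  exists T0 : R, forall y (t : rat) (T : R), T0 <= T ->
    colsub c (f y) = colsub c (f z) + ratr t *: map_mx ratr u ->
    approximable r delta T (f y).
Proof.
move=> d0 zw.
have [v [s [v0 Hv]]] := @hyperplane_through_line R n d c w u d_ge2 (chart_inj chart).
have [T0 HT0] := hyperplane_approximable s r_gt0 r_sum1 v0 d0.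
exists T0 => y t T TT yE; apply: HT0 => //; apply: (Hv _ (ratr t)) => j.
by have /rowP/(_ j) := yE; rewrite zw !mxE.
Qed.

Lemma integral_hyperplane_closed (v : 'rV[int]_n) (s : int) (z : 'rV[R]_d) :
  `|z - z0| <= rad -> ~ integral_hyperplane v s (f z) ->
  \forall y \near z, ~ integral_hyperplane v s (f y).
Proof.
move=> zr Hz.
pose phi (x : 'rV[R]_n) : R := \sum_i x 0 i * (v 0 i)%:~R.
have phi_cont : continuous phi.
  apply: continuous_big => [|i _ x]; first exact: add_continuous.
  exact: (cvgM (@coord_continuous R 1 n 0 i x) (cvg_cst _)).
have fz := analytic_at_continuous (chart_analytic chart zr).
have : {for z, continuous (phi \o f)}.
  by apply: continuous_comp => //; exact: phi_cont.
move=> /metric_continuousP/(_ `|phi (f z) - s%:~R|).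
have nz : 0 < `|phi (f z) - s%:~R|.
  by rewrite normr_gt0 subr_eq0; apply/eqP.
move=> /(_ nz)[e e0 He]; apply/nbhs_normP; exists e => // y.
rewrite /ball_/= distrC => /He; rewrite /= => Hlt Hy.
by move: Hlt; rewrite {1}/phi Hy distrC ltxx.
Qed.

(** Order of choices: the direction [u], the time [T1] from which its line approximates, a
    neighbourhood of [z] where the old approximations last until [T'], and only then [y] in it. The
    factor 1/2 in [stage] is spent on that neighbourhood. *)
Lemma stage_step (k : nat) (st : 'rV[R]_d * R * R) : stage k st ->
  exists st', stage k.+1 st' /\ refines k st st'.
Proof.
case: st => -[z rho] T [/andP[rho0 rhok] zr [w zw] T0 HT].
have zr' : `|z - z0| < rad by apply: lt_le_trans zr; rewrite ltrDl.
have [u Hu] : exists u : 'rV[rat]_d, forall e : R, 0 < e ->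
    exists (y : 'rV[R]_d) (t : rat), [/\ `|y - z| <= e,
      colsub c (f y) = colsub c (f z) + ratr t *: map_mx ratr u
    & exists2 e', 0 < e' & forall y', `|y' - y| <= e' -> avoids k (f y')].
  have [[[v s] [/= vs v0]]|none] := pselect (exists p : 'rV[int]_n * int,
      choice.unpickle k = Some p /\ p.1 != 0); last first.
    (* There is no hyperplane to escape from, so the centre may stay. *)
    exists 0 => e e0; exists z, 0; split.
    - by rewrite subrr normr0 ltW.
    - by rewrite rmorph0 scale0r addr0.
    - exists 1 => // y' _ v s vs v0; exfalso; apply: none.
      by exists (v, s).
  have [u Hu] := rational_escape s chart zr' v0.
  exists u => e e0; have [|y [t [yz yE Hy]]] := Hu (Num.min e rho).
    by rewrite lt_min e0.
  move: yz; rewrite le_min => /andP[ye yrho]; exists y, t; split=> //.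
  have yr : `|y - z0| <= rad.
    by have := ler_normD (y - z) (z - z0); rewrite subrKA; lra.
  have /nbhs_normP[e' /= e'0 He'] := integral_hyperplane_closed yr Hy.
  exists (e' / 2); first by rewrite divr_gt0.
  move=> y' y'y v' s'; rewrite vs => -[<- <-] _; apply: He'.
  by rewrite /ball_/= distrC; lra.
have delta0 (m : nat) : 0 < m.+1%:R^-1 :> R by rewrite invr_gt0.
have [T1 HT1] := hyperplane_rational_point u
  (divr_gt0 (delta0 k.+1) (ltr0Sn R 1)) zw.
pose T' := Num.max T1 (T + 1).
have near_z := near_approximable_itv T' r_gt0 (delta0 k) T0 HT.
have /metric_continuousP fz := analytic_at_continuous (chart_analytic chart (ltW zr')).
have /nbhs_normP[e1 /= e10 He1] := near_z.
have [e2 e20 He2] := fz _ e10.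
pose e := Num.min (e2 / 2) (rho / 2).
have e0 : 0 < e by rewrite lt_min !divr_gt0.
have [y [t [yz yE [e3 e30 He3]]]] := Hu _ e0.
have ee2 : e <= e2 / 2 by rewrite ge_min lexx.
have er : e <= rho / 2 by rewrite ge_min lexx orbT.
(* As [e2 / 2 + e2 / 3 < e2] and [rho / 2 + rho / 2 = rho], the new ball lies where the old
   approximations persist and inside the old ball. *)
pose rho' := Num.min (Num.min (e2 / 3) (rho / 2)) (Num.min e3 k.+2%:R^-1).
have rho'0 : 0 < rho' by rewrite !lt_min !divr_gt0// e30 delta0.
have : rho' <= rho' by []; rewrite {2}/rho' !le_min => /andP[/andP[re2 rr] /andP[re3 rk]].
exists (y, rho', T'); split; split.
- by rewrite rho'0.
- apply: le_trans zr; rewrite -(subrKA z).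
  have := ler_normD (y - z) (z - z0); rewrite subrKA.
  by lra.
- exists (w + t *: u); rewrite yE zw; apply/rowP => j.
  by rewrite !mxE rmorphD rmorphM.
- by rewrite lt_max [0 < T + 1]addr_gt0// orbT.
- move=> t' T't'; apply: HT1 yE; apply: le_trans T't'.
  by rewrite le_max lexx.
- by lra.
- by rewrite le_max lexx orbT.
- move=> y' y'y; split; first by apply: He3; exact: le_trans re3.
  move=> t' Tt'; apply: He1 => //; rewrite /ball_/= distrC; apply: He2.
  have := ler_normD (y' - y) (y - z); rewrite subrKA.
  by lra.
Qed.

Lemma stage_init : exists st, stage 0 st.
Proof.
have rad0 := chart_radius chart; have K0 := chart_const chart.
have rad20 : 0 < rad / 2 by rewrite divr_gt0.
have [w Hw] := rat_row_dense (colsub c (f z0)) (divr_gt0 rad20 K0).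
have [|z zz0 zw] := chart_open chart (x := z0) rad20 _ Hw.
  by rewrite subrr normr0 add0r; lra.
have [T0 HT0] := hyperplane_rational_point 0 (divr_gt0 ltr01 (ltr0Sn R 1)) zw.
exists (z, Num.min (rad / 2) 1, Num.max T0 1); split.
- by rewrite lt_min rad20 ltr01/= invr1 ge_min lexx orbT.
- have : Num.min (rad / 2) 1 <= rad / 2 by rewrite ge_min lexx.
  by lra.
- by exists w.
- by rewrite lt_max ltr01 orbT.
- move=> t; rewrite ge_max => /andP[T0t _]; rewrite invr1; apply: (HT0 z 0) => //.
  by rewrite rmorph0 scale0r addr0.
Qed.

End Iteration.

Theorem theorem1p2 (R : realType) (n d : nat) (M : set 'rV[R]_n)
    (r : 'I_n -> R)
    (hd : (2 <= d)%N)
    (hM : analytic_submanifold d M)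
    (hMc : connected M)
    (hMH : forall H : set 'rV[R]_n, rational_affine_hyperplane H -> ~ M `<=` H)
    (hr : forall i, 0 < r i)
    (hr1 : \sum_(i < n) r i = 1) :
  exists x : 'rV[R]_n, totally_irrational x /\ (M `&` Sing r) x.
Proof.
(* The weights sum to 1, so [n] is positive and some rational hyperplane exists; an empty [M] would
   lie in it. *)
have [i0] : exists i0 : 'I_n, True.
  case: n r hr hr1 {hM hMc hMH M} => [r' _|m _ _ _]; last by exists ord0.
  by rewrite big_ord0 => /eqP; rewrite eq_sym oner_eq0.
have e_neq0 : delta_mx 0 i0 != 0 :> 'rV[int]_n.
  by apply/rV0Pn; exists i0; rewrite mxE !eqxx.
have M0 : M !=set0.
  apply/set0P/negP => /eqP M0; apply: (hMH _ _ (_ : M `<=` _)).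
  - by exists (delta_mx 0 i0), 0; split.
  - by rewrite M0.
have [f [c [z0 [rad [K chart]]]]] := rational_chart_exists hM hMc hMH M0.
pose state := ('rV[R]_d * R * R)%type.
(* The step is made total, with a dummy value off the stages, so that it can be iterated by
   [nat_rect]. *)
have /boolp.choice[next Hnext] : forall ks : nat * state, exists st',
    stage r f c z0 rad ks.1 ks.2 ->
    stage r f c z0 rad ks.1.+1 st' /\ refines r f ks.1 ks.2 st'.
  move=> [k st]; have [Hst|nst] := pselect (stage r f c z0 rad k st).
    by have [st' Hst'] := stage_step hd hr hr1 chart Hst; exists st'.
  by exists st => /nst.
have [st0 Hst0] := stage_init hd hr hr1 chart.
pose st := nat_rect (fun=> state) st0 (fun k s => next (k, s)).
have Hst k : stage r f c z0 rad k (st k).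
  by elim: k => //= k IH; have [] := Hnext (k, st k) IH.
have Href k : refines r f k (st k) (st k.+1) by have [] := Hnext (k, st k) (Hst k).
pose z k := (st k).1.1; pose rho k := (st k).1.2; pose T k := (st k).2.
have stE k : st k = (z k, rho k, T k) by rewrite /z /rho /T -!surjective_pairing.
have Hstage k : stage r f c z0 rad k (z k, rho k, T k) by rewrite -stE.
have Href' k : refines r f k (z k, rho k, T k) (z k.+1, rho k.+1, T k.+1).
  by rewrite -!stE.
have [y Hy] : exists y, forall k, `|y - z k| <= rho k.
  apply: nested_balls => k; last by have [] := Href' k.
  by have [/andP[/ltW -> ->]] := Hstage k.
have yrad : `|y - z0| <= rad.
  have [_ H _ _ _] := Hstage 0%N; have := Hy 0%N.
  by have := ler_normD (y - z 0%N) (z 0%N - z0); rewrite subrKA; lra.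
exists (f y); split; last split; first last.
- move=> delta delta0.
  pose k0 := Num.trunc delta^-1.
  have k0d k : (k0 <= k)%N -> k.+1%:R^-1 <= delta.
    move=> k0k; rewrite -[leRHS]invrK lef_pV2 ?posrE ?invr_gt0//.
    by apply: le_trans (ltW (truncnS_gt _)) _; rewrite ler_nat ltnS.
  exists (T k0) => t Tt.
  have Tgrow m : T k0 + m%:R <= T (k0 + m)%N.
    elim: m => [|m IH]; first by rewrite addr0 addn0.
    by rewrite addnS -natr1 addrA; have [_ H _] := Href' (k0 + m)%N; lra.
  have exm : exists m, t < T (k0 + m)%N.
    exists (Num.trunc (t - T k0)).+1; apply: lt_le_trans (Tgrow _).
    by rewrite -ltrBlDl truncnS_gt.
  (* The least such index locates [t] in the window between two consecutive times; index 0 is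
     excluded by [T k0 <= t]. *)
  case: (ex_minnP exm) => -[|m]; first by rewrite addn0 ltNge Tt.
  rewrite addnS => tm mmin; have Tm : T (k0 + m)%N <= t.
    by rewrite leNgt; apply/negP => /mmin; rewrite ltnn.
  have [_ _ /(_ y (Hy _))[_ /(_ t)]] := Href' (k0 + m)%N.
  rewrite Tm /= ltW// => /(_ isT).
  apply: approximable_le; last by apply: k0d; exact: leq_addr.
  by have [_ _ _ T0 _] := Hstage (k0 + m)%N; exact: lt_le_trans Tm.
- exact: chart_image chart _ yrad.
apply: integral_totally_irrational => v s v0.
(* The hyperplane of [(v, s)] was avoided at the stage numbered by its code. *)
have [_ _ /(_ y (Hy _))[+ _]] := Href' (choice.pickle (v, s)).
by apply => //; rewrite choice.pickleK.
Qed.
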